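(* For each $\beta\in(1,2)$ we have $\tau_\beta\le 1-\frac1\beta$, and $\tau_\beta=1-\frac1\beta$ if and only if $\overline{E_\beta^+}$ is a Cantor set.
   Context: For $\beta\in(1,2)$ the $\beta$-transformation is $T_\beta:[0,1)\to[0,1)$, $T_\beta(x)=\beta x \pmod 1$. For $t\in[0,1)$ let $K_\beta(t)=\{x\in[0,1): T_\beta^n(x)\notin(0,t)\text{ for all }n\ge 0\}$. The function $t\mapsto\dim_H K_\beta(t)$ (Hausdorff dimension) is non-increasing and continuous, with value $1$ at $t=0$ and $0$ at $t=\frac1\beta$, and $\tau_\beta$ denotes the unique value in $[0,1)$ such that $\dim_H K_\beta(t)>0$ if and only if $t<\tau_\beta$. Furthermore $E_\beta^+=\{t\in[0,1): T_\beta^n(t)\ge t\text{ for all }n\ge 0\}$, and the overline denotes topological closure. *)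

(* Defs.v *)
From HB Require Import structures.
From mathcomp Require Import all_boot all_order all_algebra.
From mathcomp Require Import all_classical all_reals all_analysis.
Set Implicit Arguments.
Unset Strict Implicit.
Unset Printing Implicit Defensive.
Import Order.TTheory GRing.Theory Num.Theory.
Import numFieldNormedType.Exports.
Local Open Scope classical_set_scope.
Local Open Scope ring_scope.

(* The maximum with 0 only matters for the empty set, which gets diameter 0. *)
Definition diam (R : realType) (U : set R) : \bar R :=
  maxe 0%E (ereal_sup [set (`|x - y|)%:E | x in U & y in U]).

(* |U|^s; the empty set contributes 0 for every s >= 0, including s = 0, where
   powR gives 0 `^ 0 = 1. *)
Definition diam_pow (R : realType) (s : R) (U : set R) : \bar R :=
  if U == set0 then 0%E else poweR (diam U) s.

Definition hausdorff_premeasure (R : realType) (s delta : R) (A : set R)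
    : \bar R :=
  ereal_inf [set (\sum_(0 <= i <oo) diam_pow s (U i))%E | U in
    [set U : nat -> set R | A `<=` \bigcup_i U i /\
                            forall i, (diam (U i) <= delta%:E)%E]].

Definition hausdorff_measure (R : realType) (s : R) (A : set R) : \bar R :=
  ereal_sup [set hausdorff_premeasure s delta A | delta in
    [set delta : R | 0 < delta]].

Definition hausdorff_dim (R : realType) (A : set R) : \bar R :=
  ereal_inf [set s%:E | s in
    [set s : R | 0 <= s /\ hausdorff_measure s A = 0%E]].

(* Defined on all of R with values in [0, 1); it is only ever iterated from
   points of [0, 1). *)
Definition beta_map (R : realType) (beta x : R) : R :=
  beta * x - (Num.floor (beta * x))%:~R.

Definition survivor_set (R : realType) (beta t : R) : set R :=
  [set x | (x \in `[0, 1[) /\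
           forall n : nat, iter n (beta_map beta) x \notin `]0, t[ ].

Definition Eplus (R : realType) (beta : R) : set R :=
  [set t | (t \in `[0, 1[) /\ forall n : nat, t <= iter n (beta_map beta) t].

Definition is_critical_hole (R : realType) (beta tau : R) : Prop :=
  (tau \in `[0, 1[) /\
  forall t : R, (t \in `[0, 1[) ->
    ((0 < hausdorff_dim (survivor_set beta t))%E <-> t < tau).

(* Definite description: the unique value satisfying [is_critical_hole], which
   exists for 1 < beta < 2 because the dimension of [survivor_set beta t] is
   continuous and non-increasing in t, with value 1 at 0 and 0 at 1 / beta.
   The default 0 is then never used. *)
Definition tau (R : realType) (beta : R) : R :=
  xget 0 [set c | is_critical_hole beta c].

Lemma tauE (R : realType) (beta c : R) : is_critical_hole beta c -> tau beta = c.
Proof.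
move=> hc; apply: xget_unique => // d hd.
case: hc hd => c01 hc [d01 hd]; case: (ltgtP d c) => // h.
- by have := (hd d d01).1 ((hc d d01).2 h); rewrite ltxx.
- by have := (hc c c01).1 ((hd c c01).2 h); rewrite ltxx.
Qed.

Definition cantor_set (R : realType) (A : set R) : Prop :=
  [/\ A !=set0, compact A, perfect_set A & totally_disconnected A].

(* Main.v *)
Require Import Defs.
From HB Require Import structures.
From mathcomp Require Import all_boot all_order all_algebra.
From mathcomp Require Import all_classical all_reals all_analysis.
From mathcomp Require Import ring lra zify.
Set Implicit Arguments.
Unset Strict Implicit.
Unset Printing Implicit Defensive.
Import Order.TTheory GRing.Theory Num.Theory.
Import numFieldNormedType.Exports.
Local Open Scope classical_set_scope.
Local Open Scope ring_scope.

(** Write T for the beta-map, t0 = 1 - 1/beta, and E for E_beta^+.  The point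
    t0 is special because T t0 = beta - 1 is also the left limit of T at 1: on
    [t0, 1) the map T is injective, and gluing t0 to 1 makes it an expanding
    map of a circle whose inverse branch is a contracted rotation.  Everything
    turns on one condition between dimension and topology,

      Q : E accumulates at t0 from below          ([Eplus_reaches]).

    The dimension of K(t0) is zero ([survivor_dim0]).  Injectivity of T on
    [t0, 1) means that, from one generation of cylinders to the next, only the
    cylinder around beta - 1 can split; so n + 1 intervals of length beta^-n
    cover the orbits that stay in [t0, 1), and the points of K(t0) that fall
    into 0 are countably many.  This already bounds tau by t0.  If E misses
    [t, t0), the same holds for K(t), because the infimum of an orbit belongs
    to E ([Eplus_orbit_inf]) and therefore jumps above t0.  So positive
    dimension of every K(t) with t < t0 implies Q.

    Conversely, Q gives a horseshoe ([horseshoe]).  For a in E below t0, the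
    interval [a, t0) is expanded by T until it meets 1/beta; the part right of
    1/beta then covers [a, t0), and the part left of it reaches up to 1, where
    T has the same image as just below t0; a second point of E close to t0
    brings this part back over [a, t0) as well.  All these orbits stay above
    a, so K(a) contains a self-similar Cantor set, of positive dimension.
    Hence t0 is the critical hole exactly when Q holds
    ([critical_iff_reaches]).

    It remains to compare Q with the topology of the closure of E, which is
    always compact and totally disconnected.  The key fact is
    [Eplus_above_absurd]: if v >= t0 and the left-continuous orbit of v never
    drops below v, then E has no point above v.  Two such orbits would bound
    an arc of the circle; the arc next to 1 would then be mapped affinely into
    itself by an expanding iterate.  Under Q this applies to v = t0, so E lies
    in [0, t0], and each of its points is approximated by preimages of points
    of E close to t0 ([Eplus_dense_in_itself]): the closure is perfect.  If Q
    fails, E misses some [t, t0) but still has a point above t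
    ([Eplus_near_t0]), and by the key fact only one, which is isolated. *)

(** * Powers and periodic iteration *)

Lemma exprn_small (R : realType) (r e : R) : 0 <= r < 1 -> 0 < e ->
  exists n : nat, r ^+ n <= e.
Proof.
move=> /andP[r0 r1] e0.
have : r ^+ n @[n --> \oo] --> (0 : R) by apply: cvg_expr; rewrite ger0_norm.
move=> /cvgr0Pnorm_lt /(_ e e0)[n _ /(_ n (leqnn n))] h; exists n.
by rewrite ltW// (le_lt_trans _ h)// ler_norm.
Qed.

(** The sum of r^k over k <= n is at least (n+1) r^n; multiplying by 1 - r
    turns this into a bound that beats the linear growth of a cover. *)
Lemma natmul_expr_le (R : realType) (r : R) (n : nat) : 0 <= r <= 1 ->
  n.+1%:R * ((1 - r) * r ^+ n) <= 1 - r ^+ n.+1.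
Proof.
move=> /andP[r0 r1]; elim: n => [|n IH]; first by rewrite expr1 expr0; lra.
have rn0 : 0 <= r ^+ n by rewrite exprn_ge0.
have rn1 : r ^+ n <= 1 by rewrite exprn_ile1.
rewrite -[n.+2%:R]natr1 !exprS; move: IH rn0 rn1; rewrite exprS.
set a := r ^+ n => IH a0 a1.
have := ler_wpM2l r0 IH.
have -> : r * (n.+1%:R * ((1 - r) * a)) = n.+1%:R * ((1 - r) * (r * a)) by ring.
rewrite mulrDl mul1r => le1.
have : 0 <= (1 - r) * (1 - r * a).
  by rewrite mulr_ge0// subr_ge0// mulr_ile1.
lra.
Qed.

Lemma iter_periodic (S : Type) (f : S -> S) (p : S) (m j : nat) :
  iter m f p = p -> iter j f p = iter (j %% m) f p.
Proof.
move=> fp; rewrite {1}(divn_eq j m) addnC iterD; congr iter.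
by elim: (j %/ m)%N => [//|q IH]; rewrite mulSn iterD IH.
Qed.


(** * Hausdorff dimension: upper and lower bounds *)

Section HausdorffDimension.
Variable R : realType.
Implicit Types (s delta eps : R) (A B U : set R).

Lemma diam_ge0 U : (0 <= diam U)%E.
Proof. by rewrite /diam le_max lexx. Qed.

Lemma le_diam U x y : U x -> U y -> (`|x - y|%:E <= diam U)%E.
Proof.
move=> Ux Uy; rewrite /diam le_max; apply/orP; right.
by apply: ereal_sup_ubound; exists x => //; exists y.
Qed.

Lemma diam_le U (d : R) : 0 <= d ->
  (forall x y, U x -> U y -> `|x - y| <= d) -> (diam U <= d%:E)%E.
Proof.
move=> d0 h; rewrite /diam ge_max lee_fin d0 /=.
by apply: ge_ereal_sup => _ [x Ux [y Uy <-]]; rewrite lee_fin h.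
Qed.

Lemma diam_pow_ge0 s U : (0 <= diam_pow s U)%E.
Proof. by rewrite /diam_pow; case: ifP => // _; exact: poweR_ge0. Qed.

Lemma diam_pow_le s U (d : R) : 0 < s -> 0 <= d -> (diam U <= d%:E)%E ->
  (diam_pow s U <= (d `^ s)%:E)%E.
Proof.
move=> s0 d0 Ud; rewrite /diam_pow; case: ifP => _.
  by rewrite lee_fin powR_ge0.
rewrite -poweR_EFin; apply: gt0_ler_poweR => //; first exact: ltW.
- by rewrite in_itv /= diam_ge0 leey.
- by rewrite in_itv /= lee_fin d0 leey.
Qed.

(** The boundary cases matter: a singleton has diameter 0, and 0 `^ s is 1 for
    s = 0 but 0 for s > 0, which is still antitone in s. *)
Lemma diam_pow_exponent s s' U : 0 <= s' <= s -> (diam U <= 1)%E ->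
  (diam_pow s U <= diam_pow s' U)%E.
Proof.
move=> /andP[s'0 s's] U1; rewrite /diam_pow; case: ifP => // _.
have := diam_ge0 U; case: (diam U) U1 => //= d; rewrite !lee_fin => d1 d0.
have [->|dn0] := eqVneq d 0; last first.
  by apply: ger_powR => //; rewrite lt_neqAle eq_sym dn0 d0.
have [->|s'n0] := eqVneq s' 0; last first.
  have sn0 : s != 0 by rewrite gt_eqF// (lt_le_trans _ s's)// lt_neqAle eq_sym s'n0.
  by rewrite !powR0.
rewrite powRr0; have [->|sn0] := eqVneq s 0; first by rewrite powRr0.
by rewrite powR0// ler01.
Qed.

Lemma hausdorff_measure_ge0 s A : (0 <= hausdorff_measure s A)%E.
Proof.
apply: le_trans (_ : hausdorff_premeasure s 1 A <= _)%E; last first.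
  by apply: ereal_sup_ubound; exists 1 => /=.
apply: le_ereal_inf_tmp => _ [U _ <-].
by apply: nneseries_ge0 => i _ _; exact: diam_pow_ge0.
Qed.

Lemma hausdorff_measure_mono s A B : A `<=` B ->
  (hausdorff_measure s A <= hausdorff_measure s B)%E.
Proof.
move=> AB; apply: ge_ereal_sup => _ [delta d0 <-].
apply: le_trans (_ : hausdorff_premeasure s delta B <= _)%E; last first.
  by apply: ereal_sup_ubound; exists delta.
apply: ereal_inf_le_tmp => _ [U [BU dU] <-]; exists U => //; split=> //.
exact: subset_trans BU.
Qed.

Lemma hausdorff_dim_mono A B : A `<=` B ->
  (hausdorff_dim A <= hausdorff_dim B)%E.
Proof.
move=> AB; apply: ereal_inf_le_tmp => _ [s [s0 HB] <-]; exists s => //; split=> //.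
apply/eqP; rewrite eq_le hausdorff_measure_ge0 andbT -HB.
exact: hausdorff_measure_mono.
Qed.

Lemma hausdorff_dim_le0 A :
  (forall s delta eps, 0 < s -> 0 < delta -> 0 < eps ->
    exists U : nat -> set R, [/\ A `<=` \bigcup_i U i,
      forall i, (diam (U i) <= delta%:E)%E &
      (\sum_(0 <= i <oo) diam_pow s (U i) <= eps%:E)%E]) ->
  ~ (0 < hausdorff_dim A)%E.
Proof.
move=> h; apply/negP; rewrite -leNgt; apply/lee_addgt0Pr => s s0.
rewrite add0e; apply: ereal_inf_lbound; exists s => //=; split; first exact: ltW.
apply/eqP; rewrite eq_le hausdorff_measure_ge0 andbT.
apply: ge_ereal_sup => _ [delta /= d0 <-].
apply/lee_addgt0Pr => eps e0; rewrite add0e.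
have [U [cU dU sU]] := h s delta eps s0 d0 e0.
by apply: le_trans sU; apply: ereal_inf_lbound; exists U.
Qed.

(** The inverse of [x] is a Hölder surjection of exponent [s] onto [0, 1), so a
    cover of [A] by sets with small sum of s-th powers of diameters pulls back
    to a cover of [0, 1) by intervals of total length less than 1. *)
Lemma hausdorff_dim_gt0 A (x : R -> R) (kappa s : R) :
  0 < kappa -> 0 < s ->
  (forall y : R, 0 <= y < 1 -> A (x y)) ->
  (forall y y' : R, 0 <= y < 1 -> 0 <= y' < 1 ->
     kappa * `|y - y'| <= `|x y - x y'| `^ s) ->
  (0 < hausdorff_dim A)%E.
Proof.
move=> k0 s0 xA xs; apply: (@lt_le_trans _ _ s%:E); first by rewrite lte_fin.
apply: le_ereal_inf_tmp => _ [s' [s'0 Hs'] <-].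
rewrite lee_fin leNgt; apply/negP => s's.
have : (hausdorff_premeasure s' 1 A < (kappa / 4)%:E)%E.
  apply: (@le_lt_trans _ _ 0%E); last by rewrite lte_fin divr_gt0.
  by rewrite -Hs'; apply: ereal_sup_ubound; exists 1 => /=.
move=> /ereal_inf_lt[_ [U [cU dU] <-]] sU.
(* [e i] bounds the diameter of the preimage of [U i] in [0, 1). *)
pose e i := fine (diam_pow s' (U i)) / kappa.
have dfin i : diam_pow s' (U i) \is a fin_num.
  have dUf : diam (U i) \is a fin_num.
    rewrite ge0_fin_numE ?diam_ge0//; exact: le_lt_trans (dU i) (ltry _).
  by rewrite /diam_pow; case: ifP => // _; exact: fin_num_poweR.
have e0 i : 0 <= e i by rewrite divr_ge0 ?fine_ge0 ?diam_pow_ge0// ltW.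
have eU i (y y' : R) : 0 <= y < 1 -> 0 <= y' < 1 -> U i (x y) -> U i (x y') ->
    `|y - y'| <= e i.
  move=> y01 y'01 Uy Uy'; rewrite /e ler_pdivlMr// mulrC.
  apply: (le_trans (xs _ _ y01 y'01)).
  rewrite -lee_fin fineK//; apply: le_trans (@diam_pow_exponent s _ _ _ (dU i)); last first.
    by rewrite s'0 ltW.
  rewrite /diam_pow; case: ifP => [/eqP U0|_]; first by move: Uy; rewrite U0.
  rewrite -poweR_EFin; apply: gt0_ler_poweR; [exact: ltW| | |exact: le_diam].
    by rewrite in_itv /= lee_fin normr_ge0 leey.
  by rewrite in_itv /= diam_ge0 leey.
(* The centre [c i] is any point of the preimage, so the covering interval has
   length 2 * e i; the 4 in the bound kappa / 4 absorbs this factor. *)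
have /choice[c cP] : forall i, exists c : R, forall y : R, 0 <= y < 1 ->
    U i (x y) -> `|y - c| <= e i.
  move=> i; have [[c [c01 Uc]]|nc] := pselect (exists c, 0 <= c < 1 /\ U i (x c)).
    by exists c => y y01 Uy; exact: eU.
  by exists 0 => y y01 Uy; case: nc; exists y.
pose W i : set R := `[c i - e i, c i + e i]%classic.
have mW i : lebesgue_measure (W i) = (2 * e i)%:E.
  rewrite /W lebesgue_measure_itv /= lte_fin.
  have [->|en0] := eqVneq (e i) 0; first by rewrite subr0 addr0 ltxx mulr0.
  have ei : 0 < e i by rewrite lt_neqAle eq_sym en0 e0.
  rewrite ifT; last by lra.
  by rewrite -EFinB; apply/eqP; rewrite eqe; apply/eqP; ring.
have cW : (`[0, 1[%classic : set R) `<=` \bigcup_i W i.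
  move=> y /=; rewrite in_itv /= => y01.
  have [i _ Ui] := cU _ (xA _ y01); exists i => //.
  have := cP i y y01 Ui; rewrite ler_norml /W /= in_itv /= => /andP[? ?].
  by apply/andP; split; lra.
have : (lebesgue_measure (`[0%R, 1%R[%classic : set R) <=
        \sum_(0 <= i <oo) lebesgue_measure (W i))%E.
  by apply: measure_sigma_subadditive => // i; exact: measurable_itv.
rewrite lebesgue_measure_itv /= lte_fin ltr01 oppr0 adde0.
under eq_eseriesr do rewrite mW.
apply/negP; rewrite -ltNge.
have -> : (\sum_(0 <= i <oo) (2 * e i)%:E = (2 / kappa)%:E * \sum_(0 <= i <oo) diam_pow s' (U i))%E.
  rewrite -nneseriesZl; last by move=> i _; exact: diam_pow_ge0.
  apply: eq_eseriesr => i _; rewrite -(fineK (dfin i)) -EFinM /e; congr EFin.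
  by field; rewrite gt_eqF.
apply: (@le_lt_trans _ _ ((2 / kappa)%:E * (kappa / 4)%:E)%E).
  by apply: lee_wpmul2l; [rewrite lee_fin divr_ge0// ltW | exact: ltW].
rewrite -EFinM lte_fin.
suff -> : 2 / kappa * (kappa / 4) = 2^-1 by lra.
by field; rewrite gt_eqF.
Qed.

(** A linear number of intervals of exponentially small length is negligible at
    every exponent s > 0.  The countable part is enumerated through words and
    covered by its singletons, of diameter 0. *)
Lemma thin_cover_dim0 A B (r : R) (code : seq bool -> R) :
  0 < r < 1 ->
  (forall n : nat, exists ivs : seq (R * R), [/\ (size ivs <= n.+1)%N,
    forall x, B x -> exists2 I : R * R, I \in ivs & I.1 <= x <= I.2 &
    forall I : R * R, I \in ivs -> I.2 - I.1 <= r ^+ n]) ->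
  (forall x, A x -> B x \/ exists w, x = code w) ->
  ~ (0 < hausdorff_dim A)%E.
Proof.
move=> /andP[r0 r1] cov AB; apply: hausdorff_dim_le0 => s delta eps s0 d0 e0.
(* (r^n)^s = t^n * t^n : one factor kills n + 1, the other one tends to 0. *)
pose t := r `^ (s / 2).
have t0 : 0 < t by rewrite powR_gt0.
have t1 : t < 1.
  have := @gt0_ltr_powR R (s / 2) (divr_gt0 s0 (ltr0n _ 2)) r 1.
  by rewrite !nnegrE => /(_ (ltW r0) ler01 r1); rewrite powR1.
pose m := Num.max r t; pose e := Num.min delta (eps * (1 - t)).
have [n mn] : exists n, m ^+ n <= e.
  apply: exprn_small.
    by rewrite /m le_max ltW//= gt_max r1 t1.
  by rewrite lt_min d0 mulr_gt0// subr_gt0.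
have m0 : 0 <= m by rewrite le_max ltW.
have rn : r ^+ n <= delta.
  apply: (@le_trans _ _ (m ^+ n)); last by rewrite (le_trans mn)// ge_min lexx.
  by apply: lerXn2r; rewrite ?nnegrE ?(ltW r0)// le_max lexx.
have tn : t ^+ n <= eps * (1 - t).
  apply: (@le_trans _ _ (m ^+ n)); last by rewrite (le_trans mn)// ge_min lexx orbT.
  by apply: lerXn2r; rewrite ?nnegrE ?(ltW t0)// le_max lexx orbT.
have rns : n.+1%:R * (r ^+ n) `^ s <= eps.
  have -> : (r ^+ n) `^ s = t ^+ n * t ^+ n.
    rewrite -!powR_mulrn; [|exact: ltW|exact: ltW].
    rewrite -powRD; last by rewrite (gt_eqF t0) implybT.
    by rewrite /t -!powRrM; congr (_ `^ _); field.
  have le1 : n.+1%:R * ((1 - t) * t ^+ n) <= 1 - t ^+ n.+1.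
    by apply: natmul_expr_le; rewrite (ltW t0) (ltW t1).
  have t2 : t ^+ n.+1 >= 0 by rewrite exprn_ge0// ltW.
  have t3 : t ^+ n >= 0 by rewrite exprn_ge0// ltW.
  have := ler_wpM2l t3 (le_trans le1 (_ : 1 - t ^+ n.+1 <= 1)).
  rewrite lerBlDr lerDl t2 => /(_ isT) le2.
  rewrite -(ler_pM2r (_ : 0 < 1 - t)) ?subr_gt0//.
  apply: (le_trans _ tn); rewrite mulr1 in le2; apply: (le_trans _ le2).
  by rewrite le_eqVlt; apply/orP; left; apply/eqP; ring.
have [ivs [sz cB len]] := cov n.
pose V (I : R * R) : set R := `[I.1, I.2]%classic.
(* The intervals come first, then the singletons, indexed by [pickle]. *)
pose Z k : set R := [set x | exists2 w, pickle_inv k = Some w & x = code w].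
have Z1 k x y : Z k x -> Z k y -> x = y.
  by move=> [w kw ->] [w' kw' ->]; move: kw'; rewrite kw => -[->].
pose U i := if (i < size ivs)%N then V (nth (0, 0) ivs i) else Z (i - size ivs)%N.
have r_n0 : 0 <= r ^+ n by rewrite exprn_ge0// ltW.
have dU i : (diam (U i) <= (r ^+ n)%:E)%E.
  apply: (diam_le r_n0) => x y; rewrite /U; case: ifPn => [isz|_].
    have := len _ (mem_nth (0, 0) isz); rewrite /V /= !in_itv /=.
    move=> l /andP[? ?] /andP[? ?]; rewrite ler_norml; apply/andP; split; lra.
  by move=> /Z1 h1 /h1 ->; rewrite subrr normr0.
exists U; split.
- move=> x /AB[/cB[I Ii Ix]|[w ->]].
    exists (index I ivs) => //; by rewrite /U index_mem Ii nth_index// /V /= in_itv.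
  exists (size ivs + @pickle (seq bool) w)%N => //.
  by rewrite /U ltnNge leq_addr /= addKn; exists w => //; exact: pickleK_inv.
- by move=> i; apply: le_trans (dU i) _; rewrite lee_fin.
- rewrite (@nneseries_split _ _ 0%N (size ivs)); last by move=> k _; exact: diam_pow_ge0.
  rewrite add0n eseries0 ?adde0; last first.
    move=> i isz _; rewrite /diam_pow; case: ifPn => // Un0.
    have -> : diam (U i) = 0%E.
      apply/eqP; rewrite eq_le diam_ge0 andbT; apply: diam_le => [|x y]; first exact: lexx.
      by rewrite /U ltnNge isz /= => /Z1 h1 /h1 ->; rewrite subrr normr0.
    by apply: poweR0r; rewrite gt_eqF.
  apply: (@le_trans _ _ (\sum_(0 <= k < size ivs) ((r ^+ n) `^ s)%:E)%E).
    by apply: lee_sum => i _; exact: diam_pow_le.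
  rewrite sumEFin lee_fin big_const_nat subn0 iter_addr_0 -mulr_natl.
  apply: (le_trans _ rns); apply: ler_wpM2r; first exact: powR_ge0.
  by rewrite ler_nat.
Qed.

End HausdorffDimension.

(** * Affine behaviour of iterates of the beta-map *)

Definition critical_point (R : realType) (beta : R) : R := 1 - 1 / beta.

Section BetaDynamics.
Variables (R : realType) (beta : R).
Hypotheses (hb1 : 1 < beta) (hb2 : beta < 2).
Local Notation T := (beta_map beta).
Local Notation t0 := (critical_point beta).
Implicit Types (a b s t u v w x y z : R) (n i j k : nat).

Let b0 : 0 < beta. Proof. exact: lt_trans hb1. Qed.

Let bt0 : beta * t0 = beta - 1.
Proof. by rewrite /critical_point; field; rewrite gt_eqF. Qed.

Let t0_gt0 : 0 < t0.
Proof. by rewrite -(pmulr_rgt0 _ b0) bt0 subr_gt0. Qed.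

Let bX_gt0 n : 0 < beta ^+ n. Proof. exact: exprn_gt0. Qed.

Let bX_ge1 n : 1 <= beta ^+ n. Proof. by apply: exprn_ege1; exact: ltW. Qed.

Let mulb_lt x y : (beta * x < beta * y) = (x < y).
Proof. exact: ltr_pM2l. Qed.

Let mulb_le x y : (beta * x <= beta * y) = (x <= y).
Proof. exact: ler_pM2l. Qed.

Let bX_gt1 n : 1 < beta ^+ n.+1.
Proof. by rewrite exprn_egt1. Qed.

Let t0_01 : 0 < t0 <= 1.
Proof. by rewrite t0_gt0 /critical_point gerBl divr_ge0// ltW. Qed.

Let bt0_lt1 : beta * t0 < 1.
Proof. by rewrite bt0; move: hb2; lra. Qed.

Let divb_le x y : (x / beta <= y) = (x <= beta * y).
Proof. by rewrite ler_pdivrMr// mulrC. Qed.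

Let divb_gt x y : (y < x / beta) = (beta * y < x).
Proof. by rewrite ltr_pdivlMr// mulrC. Qed.

Lemma expr_grows (d : R) : 0 < d -> exists n, 1 < beta ^+ n * d.
Proof.
move=> d0.
have [||n hn] := @exprn_small R beta^-1 (d / 2); [|by rewrite divr_gt0|].
  by rewrite invr_ge0 ltW//= invf_lt1.
exists n; move: hn; rewrite exprVn => /(ler_wpM2l (ltW (bX_gt0 n))).
rewrite divff ?gt_eqF// mulrA => h; lra.
Qed.

Lemma beta_map_range x : 0 <= T x < 1.
Proof.
rewrite /beta_map subr_ge0 floor_le/= ltrBlDr addrC.
by have := lt_succ_floor (beta * x); rewrite intrD.
Qed.

Lemma beta_map_lo x : 0 <= x -> beta * x < 1 -> T x = beta * x.
Proof.
move=> x0 x1; rewrite /beta_map.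
rewrite (_ : Num.floor _ = 0) ?subr0//.
by apply: floor_def; rewrite mulr_ge0 ?(ltW b0)// add0r.
Qed.

Lemma beta_map_hi x : 1 <= beta * x -> x < 1 -> T x = beta * x - 1.
Proof.
move=> x0 x1; rewrite /beta_map.
rewrite (_ : Num.floor _ = 1) //.
apply: floor_def; rewrite intrD x0 /=.
by have : beta * x < beta; [rewrite gtr_pMr | move=> /lt_trans; apply].
Qed.

Lemma iter_range n x : 0 <= x < 1 -> 0 <= iter n T x < 1.
Proof. by case: n => [//|n] _; rewrite iterS; exact: beta_map_range. Qed.

(** The left-continuous version of the beta-map, a self-map of (0, 1]: it takes
    the value 1 instead of 0 at 1 / beta.  Its orbits are the limits of orbits
    of nearby points on the left. *)
Definition left_map x := if beta * x <= 1 then beta * x else beta * x - 1.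
Local Notation L := left_map.

Lemma left_map_lo x : beta * x <= 1 -> L x = beta * x.
Proof. by rewrite /left_map => ->. Qed.

Lemma left_map_hi x : 1 < beta * x -> L x = beta * x - 1.
Proof. by rewrite /left_map leNgt => ->. Qed.

Lemma left_map_range x : 0 < x <= 1 -> 0 < L x <= 1.
Proof.
move=> /andP[x0 x1]; have [h|h] := leP (beta * x) 1.
  by rewrite left_map_lo// h mulr_gt0.
rewrite left_map_hi// subr_gt0 h /=.
have : beta * x <= beta by rewrite ger_pMr.
by move: hb2; lra.
Qed.

Lemma iter_left_range n x : 0 < x <= 1 -> 0 < iter n L x <= 1.
Proof. by move=> x01; elim: n => [//|n IH]; rewrite iterS left_map_range. Qed.

Lemma beta_map_right_affine n y : 0 <= y < 1 ->
  exists2 d, 0 < d & forall z, y <= z < y + d ->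
    z < 1 /\ iter n T z = iter n T y + beta ^+ n * (z - y).
Proof.
move=> y01; have /andP[y0 y1] := y01; elim: n => [|n [d d0 IH]].
  exists (1 - y) => [|z]; first by rewrite subr_gt0.
  by rewrite expr0 mul1r /= => /andP[? ?]; split; lra.
have /andP[w0 w1] := iter_range n y01.
have bz z : beta * (iter n T y + beta ^+ n * (z - y)) =
    beta * iter n T y + beta ^+ n.+1 * (z - y).
  by rewrite exprS; ring.
have [h|h] := ltP (beta * iter n T y) 1; last first.
  exists d => // z zy; have [z1 e] := IH _ zy; have /andP[yz _] := zy.
  have bz0 : 0 <= beta ^+ n.+1 * (z - y) by rewrite mulr_ge0 ?(ltW (bX_gt0 _)) ?subr_ge0.
  have z01 : 0 <= z < 1 by rewrite z1 (le_trans y0).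
  have := iter_range n z01; rewrite !iterS e => /andP[_ iz1].
  split=> //; rewrite beta_map_hi// ?bz//; last by lra.
  by rewrite beta_map_hi//; ring.
exists (Num.min d ((1 - beta * iter n T y) / beta ^+ n.+1)).
  by rewrite lt_min d0 divr_gt0// subr_gt0.
move=> z; rewrite -ltrBlDl lt_min => /and3P[yz zd].
rewrite ltr_pdivlMr// mulrC => zb.
have [|z1 e] := IH z; first by rewrite yz; lra.
have bz0 : 0 <= beta ^+ n.+1 * (z - y) by rewrite mulr_ge0 ?(ltW (bX_gt0 _)) ?subr_ge0.
have z01 : 0 <= z < 1 by rewrite z1 (le_trans y0).
have := iter_range n z01; rewrite !iterS e => /andP[iz0 iz1].
split=> //; rewrite beta_map_lo// ?bz//; last by lra.
by rewrite beta_map_lo.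
Qed.

Lemma beta_map_left_affine n y : 0 < y <= 1 ->
  exists2 d, 0 < d & forall z, y - d < z < y ->
    0 <= z /\ iter n T z = iter n L y - beta ^+ n * (y - z).
Proof.
move=> y01; have /andP[y0 y1] := y01; elim: n => [|n [d d0 IH]].
  by exists y => // z; rewrite expr0 mul1r /= => /andP[? ?]; split; lra.
have /andP[w0 w1] := iter_left_range n y01.
have bz z : beta * (iter n L y - beta ^+ n * (y - z)) =
    beta * iter n L y - beta ^+ n.+1 * (y - z).
  by rewrite exprS; ring.
have [h|h] := leP (beta * iter n L y) 1.
  exists d => // z zy; have [z0 e] := IH _ zy; have /andP[_ zy1] := zy.
  have bz0 : 0 < beta ^+ n.+1 * (y - z) by rewrite mulr_gt0 ?subr_gt0.
  have z01 : 0 <= z < 1 by rewrite z0 (lt_le_trans zy1).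
  have := iter_range n z01; rewrite !iterS e => /andP[iz0 iz1].
  split=> //; rewrite beta_map_lo// ?bz//; last by lra.
  by rewrite left_map_lo.
exists (Num.min d ((beta * iter n L y - 1) / beta ^+ n.+1)).
  by rewrite lt_min d0 divr_gt0// subr_gt0.
move=> z; rewrite ltrBlDl -ltrBlDr lt_min => /andP[/andP[zd]].
rewrite ltr_pdivlMr// mulrC => zb zy.
have [|z0 e] := IH z; first by rewrite zy; lra.
have bz0 : 0 < beta ^+ n.+1 * (y - z) by rewrite mulr_gt0 ?subr_gt0.
have z01 : 0 <= z < 1 by rewrite z0 (lt_le_trans zy).
have := iter_range n z01; rewrite !iterS e => /andP[iz0 iz1].
split=> //; rewrite beta_map_hi// ?bz//; last by lra.
by rewrite left_map_hi//; ring.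
Qed.

(** Right-continuity of every iterate transfers the lower bound of an orbit to
    its infimum, attained or not; so the infimum is a point of E+. *)
Lemma Eplus_orbit_inf x t : 0 <= x < 1 -> (forall n, t <= iter n T x) ->
  exists m : R, [/\ Eplus beta m, t <= m & forall n, m <= iter n T x].
Proof.
move=> x01 tx; pose O := [set iter n T x | n in [set: nat]].
have O0 : O !=set0 by exists x; exists 0%N.
have lbO : has_lbound O by exists t => _ [n _ <-].
have hi : has_inf O by [].
pose m := inf O; exists m.
have mO n : m <= iter n T x by apply: ge_inf => //; exists n.
have m0 : 0 <= m.
  by apply: lb_le_inf => // _ [n _ <-]; have /andP[] := iter_range n x01.
have m1 : m < 1 by have /andP[_] := x01; apply: le_lt_trans (mO 0%N).
split=> //; last by apply: lb_le_inf => // _ [n _ <-].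
split; first by rewrite in_itv /= m0 m1.
move=> n; rewrite leNgt; apply/negP => nm; have {}nm : iter n T m < m := nm.
have [|d d0 dP] := @beta_map_right_affine n m; first by rewrite m0.
pose e := Num.min d ((m - iter n T m) / beta ^+ n).
have e0 : 0 < e by rewrite lt_min d0 divr_gt0// subr_gt0.
have [_ [k _ <-]] := inf_adherent e0 hi; rewrite -/m => kme.
have := kme; rewrite -ltrBlDl lt_min => /andP[kd].
rewrite ltr_pdivlMr// mulrC => ke.
have [|_ E] := dP (iter k T x); first by rewrite mO; lra.
have := mO (n + k)%N; rewrite iterD E; lra.
Qed.

(** At time [n] the image of [a, b) contains 1 / beta in its interior, and before
    that all iterates are affine on [a, b). *)
Definition first_cut a b n :=
  [/\ forall i, (i <= n)%N -> iter i L b = iter i T a + beta ^+ i * (b - a),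
      forall i z, (i <= n)%N -> a <= z < b ->
        iter i T z = iter i T a + beta ^+ i * (z - a),
      beta * iter n T a < 1 & 1 < beta * iter n L b].

(** Without a cut the length of the image would grow without bound in [0, 1). *)
Lemma first_cut_exists a b : 0 <= a -> a < b -> b <= 1 -> exists n, first_cut a b n.
Proof.
move=> a0 ab b1; have a01 : 0 <= a < 1 by rewrite a0 (lt_le_trans ab).
have b01 : 0 < b <= 1 by rewrite b1 (le_lt_trans a0).
apply: contrapT => nocut.
pose P n := iter n L b = iter n T a + beta ^+ n * (b - a) /\
  forall z, a <= z < b -> iter n T z = iter n T a + beta ^+ n * (z - a).
suff allP n : P n.
  have [|n] := @expr_grows (b - a); first by rewrite subr_gt0.
  have [E _] := allP n; have /andP[_] := iter_left_range n b01.
  have /andP[] := iter_range n a01; rewrite E; lra.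
have strongP k : forall i, (i <= k)%N -> P i.
  elim: k => [|k IH] i.
    by rewrite leqn0 => /eqP ->; split=> [|z _]; rewrite expr0 mul1r /=; ring.
  rewrite leq_eqVlt => /orP[/eqP ->|/IH//].
  have [EL ET] := IH k (leqnn k).
  have /andP[Ta0 Ta1] := iter_range k a01.
  have /andP[Lb0 Lb1] := iter_left_range k b01.
  have bS (d w : R) : beta * (w + beta ^+ k * d) = beta * w + beta ^+ k.+1 * d.
    by rewrite exprS; ring.
  have zpos z : a <= z < b -> 0 <= beta ^+ k.+1 * (z - a) < beta ^+ k.+1 * (b - a).
    move=> /andP[az zb]; rewrite ltr_pM2l// ltrD2r zb andbT.
    by rewrite mulr_ge0 ?subr_ge0// ltW.
  have z01 z : a <= z < b -> 0 <= z < 1.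
    by move=> /andP[az zb]; rewrite (le_trans a0)// (lt_le_trans zb).
  have [h|h] := leP 1 (beta * iter k T a); [|have [h'|h'] := leP (beta * iter k L b) 1].
  - rewrite /P !iterS beta_map_hi//; split.
      rewrite left_map_hi EL bS; first by ring.
      have : 0 < beta ^+ k.+1 * (b - a) by rewrite mulr_gt0// subr_gt0.
      lra.
    move=> z zab; have := iter_range k (z01 z zab); have := zpos z zab.
    rewrite iterS (ET z zab) => /andP[? _] /andP[_ ?].
    by rewrite beta_map_hi// bS; lra.
  - rewrite /P !iterS (beta_map_lo Ta0)// left_map_lo// EL bS; split=> // z zab.
    have := iter_range k (z01 z zab); have := zpos z zab.
    rewrite iterS (ET z zab) => /andP[? ?] /andP[? ?].
    move: h'; rewrite EL bS => h'.
    by rewrite beta_map_lo// bS; lra.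
  - case: nocut; exists k; split=> // [j /IH[]//|j z /IH[_ Pj]]; exact: Pj.
exact: (strongP n n (leqnn n)).
Qed.
(** * No point of E+ above a self-dominating left orbit *)

(** Here [z] is periodic and minimal in its orbit, and [v], [z] are first
    separated by 1 / beta one step before the period closes.  On the circle
    obtained by gluing t0 to 1, the orbit point that
    follows the largest one in cyclic order is the smallest one.  Following this pair, T^i(max) and T^i z remain neighbours in
    the orbit, with T^i(1-) <= L^i v between them; so nothing cuts the interval
    between max and 1 during one period, and this interval would be mapped into
    itself with slope beta^(n+1) > 1. *)
Lemma periodic_above_absurd v z n :
  t0 <= v -> v < z -> z < 1 -> (forall i, v <= iter i L v) ->
  iter n.+1 T z = z -> (forall i, z <= iter i T z) ->
  (forall i, (i <= n)%N -> iter i T z - iter i L v = beta ^+ i * (z - v)) ->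
  (forall i, (i < n)%N -> 1 < beta * iter i T z -> 1 < beta * iter i L v) ->
  beta * iter n L v <= 1 -> 1 < beta * iter n T z -> False.
Proof.
move=> tv vz z1 vL Tz zT dist uncut lcut zcut.
have v0 : 0 < v by exact: lt_le_trans tv.
have z0 : 0 < z by exact: lt_trans vz.
have bv : beta - 1 <= beta * v by rewrite -bt0 mulb_le.
have z01 : 0 <= z < 1 by rewrite z1 ltW.
pose zi i := iter i T z; pose l i := iter i L v; pose q i := iter i L (1 : R).
have zi1 i : zi i < 1 by have /andP[] := iter_range i z01.
have zi_gt0 i : 0 < zi i by exact: lt_le_trans (zT i).
have zine i : beta * zi i != 1.
  apply/eqP => e; have := zT i.+1; rewrite iterS -/(zi i) beta_map_hi ?e//.
  by rewrite subrr leNgt z0.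
have lo i : beta * zi i < 1 -> zi i.+1 = beta * zi i.
  by move=> h; rewrite /zi iterS beta_map_lo// ltW// zi_gt0.
have hi i : 1 < beta * zi i -> zi i.+1 = beta * zi i - 1.
  by move=> h; rewrite /zi iterS beta_map_hi// ?zi1// ltW.
have side i : (beta * zi i < 1) || (1 < beta * zi i) by rewrite -neq_lt.
have pred j : exists j', zi j = zi j'.+1.
  by exists (j + n)%N; rewrite /zi -addnS iterD Tz.
have zlo : beta * z < 1.
  have /orP[//|h] := side 0%N; have := zT 1%N; rewrite -/(zi 1%N) hi//= => h'.
  have : (beta - 1) * z < beta - 1 by rewrite gtr_pMr// subr_gt0.
  have := hb2.
  by move: h'; rewrite /zi /=; lra.
have n0 : (0 < n)%N.
  by case: (n) zcut => //; rewrite /= => h; have := lt_trans zlo h; rewrite ltxx.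
have [k kmax] : exists k, forall j, zi j <= zi k.
  pose k := [arg max_(i > ord0) zi (i : 'I_n.+1)]%O.
  exists k => j; rewrite /zi (iter_periodic j Tz) /k.
  case: arg_maxP => //= i _ /(_ (Ordinal (ltn_pmod j (ltn0Sn n)))) /=; exact.
have khi : 1 < beta * zi k by rewrite (lt_le_trans zcut)// mulb_le kmax.
(* z_n is the preimage of z on the right branch, hence the smallest orbit
   point above 1 / beta. *)
have zn_lt i : (i < n)%N -> 1 < beta * zi i -> zi n < zi i.
  move=> lin h; have := zT i.+1; rewrite -/(zi i.+1) hi//.
  rewrite -[X in X <= _]Tz -/(zi n.+1) (hi n)// lerD2r mulb_le le_eqVlt.
  case/orP => // /eqP e; have e' : zi i.+1 = z by rewrite hi// -e -hi.
  have := dist _ lin; rewrite -/(zi i.+1) e'; have := vL i.+1.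
  have : (z - v) < beta ^+ i.+1 * (z - v) by rewrite ltr_pMl// subr_gt0.
  lra.
have bS i (d w : R) : w = beta ^+ i * d -> beta * w = beta ^+ i.+1 * d.
  by move=> ->; rewrite exprS; ring.
(* The neighbours z_(k+i) and z_i, with the images q_i of 1 and l_i of v
   between them. *)
have adj i : (i < n)%N -> [/\ zi (k + i.+1)%N < q i.+1, q i.+1 <= l i.+1,
    forall j, ~ (zi (k + i.+1)%N < zi j < zi i.+1) &
    q i.+1 - zi (k + i.+1)%N = beta ^+ i.+1 * (1 - zi k)].
  elim: i => [|i IH] lin.
    have l1 : l 1%N = beta * v.
      by rewrite /l /= left_map_lo// ltW// (lt_trans _ zlo)// mulb_lt.
    have q1 : q 1%N = beta - 1 by rewrite /q /= left_map_hi mulr1.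
    rewrite addn1 hi// l1 q1 expr1 lo//; split=> //.
    - by rewrite ltrD2r gtr_pMr.
    - move=> j; have [j' ->] := pred j; have /orP[h|h] := side j'.
        by rewrite lo// !mulb_lt => /andP[_]; rewrite ltNge zT.
      by rewrite hi// ltrD2r mulb_lt => /andP[]; rewrite ltNge kmax.
    - by ring.
  have {IH} [|zq ql nj dq] := IH; first exact: ltnW.
  have lz : l i.+1 < zi i.+1.
    have := dist _ (ltnW lin); rewrite -/(zi _) -/(l _).
    have : 0 < beta ^+ i.+1 * (z - v) by rewrite mulr_gt0// subr_gt0.
    lra.
  have [zlo'|zhi'] : beta * zi i.+1 < 1 \/ 1 < beta * zi (k + i.+1)%N.
    have /orP[h|h] := side i.+1; first by left.
    have /orP[h'|h'] := side (k + i.+1)%N; last by right.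
    by case: (nj n); rewrite (zn_lt _ lin)// andbT -mulb_lt (lt_trans h').
  - have llo : beta * l i.+1 < 1 by rewrite (lt_trans _ zlo')// mulb_lt.
    have qlo : beta * q i.+1 < 1 by rewrite (le_lt_trans _ llo)// mulb_le.
    have zklo : beta * zi (k + i.+1)%N < 1 by rewrite (lt_trans _ qlo)// mulb_lt.
    have qS : q i.+2 = beta * q i.+1 by rewrite {1}/q iterS left_map_lo// ltW.
    have lS : l i.+2 = beta * l i.+1 by rewrite {1}/l iterS left_map_lo// ltW.
    rewrite addnS lo// lo// qS lS; split.
    + by rewrite mulb_lt.
    + by rewrite mulb_le.
    + move=> j; have [j' ->] := pred j; have /orP[h|h] := side j'.
        by rewrite lo// !mulb_lt; exact: nj.
      rewrite hi// => /andP[h1 _].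
      have : beta * v < beta * zi (k + i.+1)%N.
        by rewrite mulb_lt; exact: lt_le_trans (zT _).
      have : beta * zi j' < beta by rewrite gtr_pMr.
      lra.
    + by rewrite -mulrBr; exact: bS.
  - have qhi : 1 < beta * q i.+1 by rewrite (lt_trans zhi')// mulb_lt.
    have lhi : 1 < beta * l i.+1 by rewrite (lt_le_trans qhi)// mulb_le.
    have zhi : 1 < beta * zi i.+1 by rewrite (lt_trans lhi)// mulb_lt.
    have qS : q i.+2 = beta * q i.+1 - 1 by rewrite {1}/q iterS left_map_hi.
    have lS : l i.+2 = beta * l i.+1 - 1 by rewrite {1}/l iterS left_map_hi.
    rewrite addnS hi// hi// qS lS; split.
    + by rewrite ltrD2r mulb_lt.
    + by rewrite lerD2r mulb_le.
    + move=> j; have [j' ->] := pred j; have /orP[h|h] := side j'.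
        rewrite lo// => /andP[_ h1].
        have : beta * v < beta * zi j'.
          by rewrite mulb_lt; exact: lt_le_trans (zT _).
        have : beta * zi i.+1 < beta by rewrite gtr_pMr.
        lra.
      by rewrite hi// !ltrD2r !mulb_lt; exact: nj.
    + by rewrite -(bS _ _ _ dq); ring.
have [] := adj n.-1; rewrite prednK// => zq ql _ dq.
have qlo : beta * q n <= 1 by rewrite (le_trans _ lcut)// mulb_le.
have zklo : beta * zi (k + n)%N < 1 by rewrite (lt_le_trans _ qlo)// mulb_lt.
have q01 : 0 < (1 : R) <= 1 by rewrite ltr01 lexx.
have /andP[_] := iter_left_range n.+1 q01.
rewrite iterS -/(q n) left_map_lo// => qle.
have zk : beta * zi (k + n)%N = zi k.
  by rewrite -lo// /zi -addnS iterD Tz.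
have : (1 - zi k) < beta ^+ n.+1 * (1 - zi k) by rewrite ltr_pMl// subr_gt0.
rewrite -(bS _ _ _ dq); have := zi1 k; move: qle zk; lra.
Qed.

(** As for [first_cut_exists], but the left end follows [left_map], so that it
    may sit exactly on 1 / beta when the cut occurs. *)
Lemma first_separation v w :
  0 < v -> v < w -> w < 1 -> (forall i, v <= iter i L v) ->
  (forall i, 0 < iter i T w) -> exists n,
  [/\ forall i, (i <= n)%N -> iter i T w - iter i L v = beta ^+ i * (w - v),
      forall i, (i < n)%N -> 1 < beta * iter i T w -> 1 < beta * iter i L v,
      beta * iter n L v <= 1 & 1 < beta * iter n T w].
Proof.
move=> v0 vw w1 vL wT; have w0 : 0 < w by exact: lt_trans vw.
have w01 : 0 <= w < 1 by rewrite w1 ltW.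
pose cut i := (beta * iter i L v <= 1) && (1 < beta * iter i T w).
have step i : ~~ cut i -> iter i T w - iter i L v = beta ^+ i * (w - v) ->
    iter i.+1 T w - iter i.+1 L v = beta ^+ i.+1 * (w - v).
  move=> ncut E; have Tw0 := wT i; have /andP[_ Tw1] := iter_range i w01.
  have lt_lw : iter i L v < iter i T w.
    by rewrite -subr_gt0 E mulr_gt0// subr_gt0.
  rewrite !iterS exprS -mulrA -E; move: ncut; rewrite negb_and -ltNge -leNgt.
  case/orP => h.
    by rewrite left_map_hi// beta_map_hi//; [ring | rewrite ltW// (lt_trans h) ?mulb_lt].
  have h' : beta * iter i T w < 1.
    rewrite lt_neqAle h andbT; apply/eqP => e.
    by have := wT i.+1; rewrite iterS beta_map_hi ?e// subrr ltxx.
  rewrite left_map_lo ?beta_map_lo//; [by ring| exact: ltW|].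
  by rewrite ltW// (lt_trans _ h')// mulb_lt.
have dist k : (forall i, (i < k)%N -> ~~ cut i) ->
    iter k T w - iter k L v = beta ^+ k * (w - v).
  elim: k => [|k IH] nc; first by rewrite expr0 mul1r.
  by apply: step; [exact: nc | apply: IH => i ik; exact/nc/ltnW].
have [excut|nocut] := pselect (exists n, cut n).
  case: (ex_minnP excut) => n /andP[cl cw] nmin.
  have nc i : (i < n)%N -> ~~ cut i.
    by move=> ilt; apply/negP => /nmin; rewrite leqNgt ilt.
  exists n; split=> // [i ile|i ilt h].
    by apply: dist => j jlt; apply: nc; exact: leq_trans ile.
  by have := nc i ilt; rewrite /cut h andbT -ltNge.
have [|n] := @expr_grows (w - v); first by rewrite subr_gt0.
rewrite -dist; last by move=> i _; apply/negP => c; apply: nocut; exists i.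
have /andP[_] := iter_range n w01; have := vL n; lra.
Qed.

(** When v and w are first separated, the right part of the interval returns
    over itself and yields a periodic point z in (v, w] whose orbit stays above
    v.  The least point of this orbit is separated from v at the same time:
    earlier is impossible since it lies below w, and later would let L^(n+1) v
    drop below v. *)
Lemma Eplus_above_absurd v w : t0 <= v -> (forall i, v <= iter i L v) ->
  Eplus beta w -> v < w -> False.
Proof.
move=> tv vL [w01 wT] vw; have v0 : 0 < v by exact: lt_le_trans tv.
have w0 : 0 < w by exact: lt_trans vw.
move: w01; rewrite in_itv /= => /andP[_ w1].
have w01 : 0 <= w < 1 by rewrite w1 ltW.
have wT0 i : 0 < iter i T w by exact: lt_le_trans (wT i).
have [n [dist uncut lcut ycut]] := first_separation v0 vw w1 vL wT0.
set y := fun i => iter i T w; set l := fun i => iter i L v.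
have ym : y n.+1 = beta * y n - 1.
  by rewrite /y iterS beta_map_hi// ?ltW//; have /andP[] := iter_range n w01.
have b1 : 0 < beta ^+ n.+1 - 1 by rewrite subr_gt0.
(* z solves T^(n+1) z = z on the branch through w. *)
pose z := w - (y n.+1 - w) / (beta ^+ n.+1 - 1).
have zE : beta ^+ n.+1 * (w - z) = y n.+1 - z.
  by rewrite /z; field; rewrite gt_eqF.
have zw : z <= w by rewrite gerBl divr_ge0 ?(ltW b1)// subr_ge0; exact: wT.
have dm : beta ^+ n.+1 * (w - v) = y n.+1 + 1 - beta * l n.
  by rewrite exprS -mulrA -dist// ym /y /l; ring.
have vz : v < z.
  rewrite ltNge; apply/negP => zv.
  have : 0 <= (beta ^+ n.+1 - 1) * (v - z) by rewrite mulr_ge0 ?(ltW b1)// subr_ge0.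
  move: zE dm; set B := beta ^+ n.+1 => zE dm; have := lcut; rewrite -/(l n); lra.
have z01 : 0 <= z < 1 by rewrite (le_lt_trans zw)// ltW// (lt_trans v0).
have orb i : (i <= n)%N -> iter i T z = y i - beta ^+ i * (w - z).
  elim: i => [|i IH] ilt; first by rewrite expr0 mul1r /y /=; ring.
  have {}IH := IH (ltnW ilt).
  have zl : l i < iter i T z.
    have : 0 < beta ^+ i * (z - v) by rewrite mulr_gt0// subr_gt0.
    have := dist i (ltnW ilt); rewrite IH -/(y i) -/(l i); lra.
  have zy : iter i T z <= y i.
    by rewrite IH gerBl mulr_ge0 ?subr_ge0// ltW.
  have yS : iter i.+1 T w = T (y i) by [].
  have /andP[z0 z1] := iter_range i z01; have /andP[y0 y1] := iter_range i w01.
  rewrite iterS [y i.+1]yS exprS; have [h|h] := ltP (beta * y i) 1.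
    by rewrite !beta_map_lo// ?IH; [ring|rewrite (le_lt_trans _ h)// mulb_le -IH].
  have h' : 1 < beta * y i.
    rewrite lt_neqAle h andbT; apply/eqP => e.
    by have := wT0 i.+1; rewrite yS beta_map_hi -?e// subrr ltxx.
  have hz : 1 < beta * iter i T z.
    by rewrite (lt_trans (uncut i ilt h'))// mulb_lt.
  by rewrite !beta_map_hi// ?ltW// IH; ring.
have Tz : iter n.+1 T z = z.
  have E : beta * iter n T z - 1 = z.
    rewrite orb// mulrBr mulrA -exprS zE ym; ring.
  have /andP[_ zn1] := iter_range n z01.
  by rewrite iterS beta_map_hi// -subr_ge0 E ltW// (lt_trans v0).
have [j jmin] : exists j : 'I_n.+1, forall i, iter j T z <= iter i T z.
  exists [arg min_(i < ord0) iter (i : 'I_n.+1) T z]%O => i.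
  rewrite (iter_periodic i Tz).
  by case: arg_minP => //= k _ /(_ (Ordinal (ltn_pmod i (ltn0Sn n))) isT).
pose u := iter j T z.
have vu : v < u.
  have jn : (j <= n)%N by rewrite -ltnS ltn_ord.
  have : 0 < beta ^+ j * (z - v) by rewrite mulr_gt0// subr_gt0.
  have := dist j jn; have := vL j; rewrite /u orb// -/(y j) -/(l j); lra.
have uw : u <= w by rewrite (le_trans _ zw)// (jmin 0%N).
have Tu : iter n.+1 T u = u by rewrite /u -iterD addnC iterD Tz.
have uT i : u <= iter i T u by rewrite /u -iterD; exact: jmin.
have u1 : u < 1 by exact: le_lt_trans w1.
have u0 : 0 < u by exact: lt_trans vu.
have [|n' [dist' uncut' lcut' ucut']] := first_separation v0 vu u1 vL _.
  by move=> i; exact: lt_le_trans (uT i).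
suff nn' : n' = n by subst n'; exact: (periodic_above_absurd tv vu u1 vL Tu uT dist').
case: (ltngtP n' n) => // [lt_n'n|lt_nn'].
  have : 1 < beta * y n'.
    apply: (lt_le_trans ucut'); rewrite mulb_le.
    have := dist' n' (leqnn _); have := dist n' (ltnW lt_n'n).
    have : beta ^+ n' * (u - v) <= beta ^+ n' * (w - v) by rewrite ler_pM2l// lerD2r.
    rewrite -/(y n'); lra.
  by move=> /(uncut _ lt_n'n); rewrite ltNge lcut'.
have := dist' n.+1 lt_nn'; rewrite Tu => Ed.
have grow : u - v < beta ^+ n.+1 * (u - v) by rewrite ltr_pMl// subr_gt0.
by exfalso; have := vL n.+1; lra.
Qed.

(** * Points of E+ near the critical point *)

Definition Eplus_reaches :=
  forall t, t < t0 -> exists2 a, Eplus beta a & t <= a < t0.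

(** Points of E+ just below t0 shadow the left orbit of t0. *)
Lemma left_orbit_t0_ge : Eplus_reaches -> forall i, t0 <= iter i L t0.
Proof.
move=> Q i; rewrite leNgt; apply/negP => li.
have [d d0 dP] := @beta_map_left_affine i t0 t0_01.
have [|a [_ aT] /andP[la at0]] := Q (Num.max (iter i L t0) (t0 - d / 2)).
  by rewrite gt_max li; lra.
move: la; rewrite ge_max => /andP[la da].
have [|_ E] := dP a; first by rewrite at0 andbT; lra.
have : 0 < beta ^+ i * (t0 - a) by rewrite mulr_gt0// subr_gt0.
have := aT i; rewrite E; lra.
Qed.

(** Right of t, choose x whose orbit follows that of t up to the first cut, lands
    on z = a + 1 / beta and then follows a, where a in E+ is close to t0.  The
    distance between the orbits of x and t grows, so the inequality T^i x >= x is
    inherited from t before the cut; after it, it is inherited from a > x. *)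
Lemma Eplus_dense_in_itself : Eplus_reaches -> forall t e, Eplus beta t -> 0 < e ->
  exists2 x, Eplus beta x & (x != t) /\ `|x - t| < e.
Proof.
move=> Q t e Et e0; have [tt0|t0t|tt0] := ltgtP t t0; last 1 first.
- rewrite tt0; have [|a Ea /andP[la at0]] := Q (t0 - e / 2); first by lra.
  exists a => //; split; first by rewrite lt_eqF.
  by rewrite ltr_norml; apply/andP; split; lra.
- move: Et => [+ tT]; rewrite in_itv /= => /andP[tge0 t1].
  pose d := Num.min e (t0 - t) / 2; pose b := t + d.
  have d0 : 0 < d by rewrite divr_gt0// lt_min e0 subr_gt0.
  have de : d < e by rewrite /d; have := ge_min e e (t0 - t); rewrite lexx /=; lra.
  have dt : b < t0.
    by rewrite /b /d; have := ge_min (t0 - t) e (t0 - t); rewrite lexx orbT; lra.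
  have tb : t < b by rewrite ltrDl.
  have b1 : b <= 1 by have /andP[_] := t0_01; lra.
  have [n [nL nT cutl cutr]] := first_cut_exists tge0 tb b1.
  (* The midpoint with t0 makes z strictly larger than beta * T^n t, which is
     what separates x from t. *)
  pose s := Num.max b ((beta * iter n T t - 1 / beta + t0) / 2).
  have st0 : s < t0.
    by rewrite gt_max dt /=; move: cutl; rewrite /critical_point; lra.
  have [a Ea /andP[]] := Q s st0; rewrite ge_max => /andP[ba ca] at0.
  pose z := a + 1 / beta.
  have bz : beta * z = beta * a + 1 by rewrite /z; field; rewrite gt_eqF.
  have z1 : z < 1 by rewrite /z; move: at0; rewrite /critical_point; lra.
  have a0 : 0 <= a by lra.
  have z0 : 0 <= z by rewrite addr_ge0// divr_ge0// ltW.
  have zt : beta * iter n T t < z by rewrite /z; move: at0 ca; rewrite /critical_point; lra.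
  pose x := t + (z / beta - iter n T t) / beta ^+ n.
  have xt : t < x.
    by rewrite ltrDl divr_gt0// subr_gt0 ltr_pdivlMr// mulrC.
  have Ex : beta ^+ n * (x - t) = z / beta - iter n T t.
    by rewrite /x; field; rewrite !gt_eqF.
  have xb : x < b.
    rewrite -(ltrD2r (- t)) -(ltr_pM2l (bX_gt0 n)) Ex ltrBlDl -nL//.
    by rewrite ltr_pdivrMr// mulrC (lt_trans z1).
  have Tn i : (i <= n)%N -> iter i T x = iter i T t + beta ^+ i * (x - t).
    by move=> ilt; apply: nT => //; rewrite xb ltW.
  have Tn1 : iter n.+1 T x = z.
    have bzb : beta * (z / beta) = z by field; rewrite gt_eqF.
    rewrite iterS Tn// Ex subrKC beta_map_lo ?bzb//.
    by rewrite divr_ge0// ltW.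
  have Ta : T z = T a.
    rewrite beta_map_hi ?bz//; last by rewrite lerDr mulr_ge0// ltW.
    by rewrite beta_map_lo ?addrK// (lt_trans _ bt0_lt1)// mulb_lt.
  exists x; last first.
    split; first by rewrite gt_eqF.
    by rewrite ger0_norm ?subr_ge0 ?ltW//; move: xb; rewrite /b; lra.
  split; first by rewrite in_itv /=; apply/andP; split; lra.
  move=> i; have [ilt|] := leqP i n.
    rewrite Tn//.
    have : x - t <= beta ^+ i * (x - t) by rewrite ler_peMl// subr_ge0 ltW.
    have := tT i;  lra.
  move=> /subnK <-; rewrite iterD Tn1; case: (i - n.+1)%N => [|j].
    by rewrite /= /z; have : 0 < 1 / beta by [rewrite divr_gt0]; lra.
  rewrite iterSr Ta -iterSr; have [_ /(_ j.+1)] := Ea;  lra.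
- by case: (Eplus_above_absurd (lexx t0) (left_orbit_t0_ge Q) Et t0t).
Qed.

(** * Surviving orbits above every level below the critical point *)

Section SurvivingOrbit.
Variable s : R.
Hypotheses (s0 : 0 < s) (st0 : s < t0).
Let eta := t0 - s.

(** For s < t0 the two branches of T, applied to [s, 1 - eta], overlap by enough
    that every point of [s, 1 - eta] has a preimage there at distance at least
    eta / beta from 1 / beta on the left.  Hence the discontinuity is avoided
    and the sets below, of points with n such steps, are closed. *)
Fixpoint slack_cylinder n : set R :=
  if n is n'.+1 then
    (`[s, (1 - eta) / beta] `&` (fun x => beta * x) @^-1` slack_cylinder n') `|`
    (`[1 / beta, 1 - eta] `&` (fun x => beta * x - 1) @^-1` slack_cylinder n')
  else `[s, 1 - eta].

Lemma slack_cylinder_closed n : closed (slack_cylinder n).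
Proof.
elim: n => [|n IH] /=; first exact: itv_closed.
have c1 : continuous (fun x : R => beta * x) by exact: mulrl_continuous.
have c2 : continuous (fun x : R => beta * x - 1).
  by move=> x; apply: cvgB; [exact: c1|exact: cvg_cst].
apply: closedU; apply: closedI; try exact: itv_closed.
- by apply: closed_comp => // x _; exact: c1.
- by apply: closed_comp => // x _; exact: c2.
Qed.

Let eta_lt1 : s <= 1 - eta.
Proof.
have : 0 <= 1 / beta by rewrite divr_ge0// ltW.
by rewrite /eta /critical_point; lra.
Qed.

Lemma slack_cylinder_sub n x : slack_cylinder n x -> s <= x <= 1 - eta.
Proof.
case: n => [|n] /=; first by rewrite in_itv.
have e0 : 0 < eta by rewrite subr_gt0.
case=> -[+ _]; rewrite in_itv /= => /andP[a c].
  rewrite a (le_trans c)// ler_pdivrMr// ler_peMr ?ltW//.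
  by apply: lt_le_trans eta_lt1.
rewrite c andbT (le_trans _ a)//; move: st0 hb2.
rewrite /critical_point => h1 h2; apply: ltW; apply: (lt_trans h1).
by rewrite -mulb_lt mulrBr mulr1 mulrCA divff ?gt_eqF// mulr1; lra.
Qed.

Lemma slack_cylinder_nonempty n : slack_cylinder n !=set0.
Proof.
elim: n => [|n [y Cy]]; first by exists s; rewrite /= in_itv /= lexx eta_lt1.
have /andP[sy ye] := slack_cylinder_sub Cy.
have [h|h] := leP (beta * s) y.
  exists (y / beta); left; split.
    by rewrite /= in_itv /= ler_pdivlMr// mulrC h ler_pM2r// invr_gt0.
  by rewrite /= mulrC divfK ?gt_eqF.
exists ((y + 1) / beta); right; split.
  rewrite /= in_itv /= ler_pM2r ?invr_gt0// lerDr (le_trans (ltW s0) sy) /=.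
  rewrite ler_pdivrMr//; move: h; rewrite /eta.
  have -> : (1 - (t0 - s)) * beta = beta - beta * t0 + beta * s by ring.
  by rewrite bt0; lra.
by rewrite /= mulrC divfK ?gt_eqF// addrK.
Qed.

Lemma slack_cylinder_desc n : slack_cylinder n.+1 `<=` slack_cylinder n.
Proof.
elim: n => [|n IH] x /=.
  by move=> /(@slack_cylinder_sub 1); rewrite in_itv.
by case=> -[h1 /IH h2]; [left|right].
Qed.

Lemma slack_cylinder_orbit n x i : slack_cylinder n x -> (i <= n)%N ->
  s <= iter i T x.
Proof.
elim: n x i => [|n IH] x i Cx.
  by rewrite leqn0 => /eqP ->; have /andP[] := slack_cylinder_sub Cx.
case: i => [_|i ilt]; first by have /andP[] := slack_cylinder_sub Cx.
have e0 : 0 < eta by rewrite subr_gt0.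
have /andP[sx xe] := slack_cylinder_sub Cx; rewrite iterSr.
move: Cx => /= -[] [] /= ; rewrite in_itv /= => /andP[h1 h2] Cx.
  rewrite beta_map_lo; [exact: IH|exact: le_trans (ltW s0) sx|].
  by move: h2; rewrite ler_pdivlMr// mulrC => h2; lra.
rewrite beta_map_hi; [exact: IH| |by lra].
by rewrite mulrC -ler_pdivrMr.
Qed.

Lemma orbit_above_exists : exists2 x, 0 <= x < 1 & forall i, s <= iter i T x.
Proof.
have e0 : 0 < eta by rewrite subr_gt0.
have /choice[u uC] : forall n, exists x, slack_cylinder n x.
  by move=> n; have [x] := slack_cylinder_nonempty n; exists x.
have uC' n k : (n <= k)%N -> slack_cylinder n (u k).
    elim: k n => [|k IH] n; first by rewrite leqn0 => /eqP ->.
    rewrite leq_eqVlt => /orP[/eqP -> //|nk].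
    have : forall j, slack_cylinder (n + j)%N `<=` slack_cylinder n.
      elim=> [|j IHj]; first by rewrite addn0.
      by rewrite addnS => x /slack_cylinder_desc /IHj.
    by move=> /(_ (k.+1 - n)%N); rewrite subnKC ?(ltnW nk)//; apply.
have [x [_ xcl]] : `[s, 1 - eta]%classic `&` cluster (u @ \oo) !=set0.
  apply: segment_compact; exists 0%N => // n _ /=.
  by have := slack_cylinder_sub (uC n); rewrite in_itv.
have xC n : slack_cylinder n x.
  apply: slack_cylinder_closed => B xB.
  apply: xcl => //; exists n => // k /= nk; exact: uC'.
exists x.
  by have /andP[h1 h2] := slack_cylinder_sub (xC 0%N); have := s0 => s0'; apply/andP; split; lra.
by move=> i; exact: slack_cylinder_orbit (xC i) (leqnn i).
Qed.

End SurvivingOrbit.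

(** Compactness only gives E+ a point above [t]; whether it lies below or above t0
    is exactly what distinguishes the two cases of the theorem. *)
Lemma Eplus_near_t0 t : t < t0 -> exists2 e, Eplus beta e & t <= e.
Proof.
move=> tt0; pose s := Num.max t (t0 / 2).
have s0 : 0 < s by rewrite lt_max divr_gt0// orbT.
have st0 : s < t0 by rewrite gt_max tt0; have := t0_gt0; lra.
have [x x01 xs] := orbit_above_exists s0 st0.
have [e [Ee se _]] := Eplus_orbit_inf x01 xs.
by exists e => //; rewrite (le_trans _ se)// le_max lexx.
Qed.

(** A nonzero point of E+ never hits 1 / beta, whose image is 0. *)
Lemma left_orbit_Eplus t : 0 < t -> Eplus beta t -> forall i, t <= iter i L t.
Proof.
move=> tgt0 [+ tT] i; rewrite in_itv /= => t01.
suff -> : iter i L t = iter i T t by exact: tT.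
elim: i => [//|i IH]; rewrite !iterS IH.
have /andP[Ti0 Ti1] := iter_range i t01.
have [h|h|h] := ltgtP (beta * iter i T t) 1.
- by rewrite left_map_lo ?beta_map_lo// ltW.
- by rewrite left_map_hi ?beta_map_hi// ltW.
- have := tT i.+1; rewrite iterS beta_map_hi ?h//.
  by rewrite subrr leNgt tgt0.
Qed.

(** * The closure of E+ *)

(** If E+ missed [t, t0), it would have a single point above t, by
    [Eplus_above_absurd] applied to any two of them. *)
Lemma perfect_Eplus_reaches : perfect_set (closure (Eplus beta)) -> Eplus_reaches.
Proof.
move=> [_ perf] t tt0; apply: contrapT => gap.
have [e Ee te] := Eplus_near_t0 tt0.
have above a : Eplus beta a -> t <= a -> t0 <= a.
  by move=> Ea ta; rewrite leNgt; apply/negP => at0; apply: gap; exists a; rewrite ?ta.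
have uniq_e a : Eplus beta a -> t <= a -> a = e.
  move=> Ea ta; have [ae|ea|//] := ltgtP a e; exfalso.
    apply: (Eplus_above_absurd (above a Ea ta) _ Ee ae).
    by apply: left_orbit_Eplus => //; apply: lt_le_trans (above a Ea ta).
  apply: (Eplus_above_absurd (above e Ee te) _ Ea ea).
  by apply: left_orbit_Eplus => //; apply: lt_le_trans (above e Ee te).
have : limit_point (closure (Eplus beta)) e by rewrite perf; exact: subset_closure.
have oe : open [set y : R | t < y] by exact: open_gt.
case/(_ [set y : R | t < y]).
  by apply: open_nbhs_nbhs; split => //=; apply: lt_le_trans (above e Ee te).
move=> y [ye ycl /= ty].
have [|a [Ea [/= ta ae]]] := ycl ([set z : R | t < z] `&` [set z : R | z != e]).
  apply: open_nbhs_nbhs; split; last by split.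
  by apply: openI => //; exact: open_neq.
by move: ae; rewrite (uniq_e a Ea (ltW ta)) eqxx.
Qed.

Lemma closure_Eplus_sub : closure (Eplus beta) `<=` `[0, 1].
Proof.
have -> : `[0, 1]%classic = closure (`[0, 1]%classic : set R).
  by apply/closure_id; exact: itv_closed.
apply: closureS => x [+ _]; rewrite /= !in_itv /= => /andP[-> /ltW ->] //.
Qed.

Lemma closure_Eplus_compact : compact (closure (Eplus beta)).
Proof.
apply: (subclosed_compact _ (@segment_compact R 0 1)).
- exact: closed_closure.
- exact: closure_Eplus_sub.
Qed.

Lemma Eplus0 : Eplus beta 0.
Proof.
split; first by rewrite in_itv /= lexx ltr01.
by move=> n; have /andP[] := @iter_range n 0 (introT andP (conj (lexx 0) ltr01)).
Qed.

(** After the first cut, the points just right of the preimage of 1 / beta land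
    near 0, hence below where they started. *)
Lemma Eplus_nowhere_dense a b : 0 < a -> a < b -> b <= 1 ->
  exists x, [/\ a < x, x < b & ~ closure (Eplus beta) x].
Proof.
move=> a0 ab b1.
have [n [nL nT cutl cutr]] := first_cut_exists (ltW a0) ab b1.
have E := nL n (leqnn n).
pose f x := beta * (iter n T a + beta ^+ n * (x - a)).
have fE x : f x = beta * iter n T a + beta ^+ n.+1 * (x - a).
  by rewrite /f exprS; ring.
pose e := Num.min a (f b - 1) / 2.
have e0 : 0 < e by rewrite divr_gt0// lt_min a0 subr_gt0 /f -E.
have ea : e < a by move: e0; rewrite /e; have := ge_min a a (f b - 1); rewrite lexx /=; lra.
have eb : e < f b - 1.
  by move: e0; rewrite /e; have := ge_min (f b - 1) a (f b - 1); rewrite lexx orbT; lra.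
pose g y := a + (y - beta * iter n T a) / beta ^+ n.+1.
have fg y : f (g y) = y by rewrite fE /g; field; rewrite gt_eqF.
have f_lt x y : (f x < f y) = (x < y) by rewrite !fE ltrD2l ltr_pM2l// ltrD2r.
have fa : f a < 1 by rewrite fE subrr mulr0 addr0.
pose x := g (1 + e / 2); exists x.
have ax : a < x by rewrite -f_lt fg; lra.
have xb : x < b by rewrite -f_lt fg; lra.
split=> // xcl.
have [|y [[y01 yT] [/= y1 y2]]] := xcl ([set y : R | g 1 < y] `&` [set y : R | y < g (1 + e)]).
  apply: open_nbhs_nbhs; split; first by apply: openI; [exact: open_gt|exact: open_lt].
  by split => /=; rewrite -f_lt !fg; lra.
rewrite -f_lt fg in y1; rewrite -f_lt fg in y2.
have ay : a < y by rewrite -f_lt; lra.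
have yb : y < b by rewrite -f_lt; lra.
have Ty : iter n.+1 T y = f y - 1.
  have yab : a <= y < b by rewrite yb ltW.
  have e' : beta * iter n T y = f y by rewrite (nT n y (leqnn n) yab).
  move: y01; rewrite in_itv /= => y01; have /andP[_ ?] := iter_range n y01.
  by rewrite beta_map_hi ?e'// ltW.
have := yT n.+1; rewrite Ty; lra.
Qed.

Lemma closure_Eplus_totally_disconnected :
  totally_disconnected (closure (Eplus beta)).
Proof.
have key x y : closure (Eplus beta) x -> closure (Eplus beta) y -> x < y ->
    exists z, [/\ x < z, z < y & ~ closure (Eplus beta) z].
  move=> /closure_Eplus_sub; rewrite /= in_itv /= => /andP[x0 x1].
  move=> /closure_Eplus_sub; rewrite /= in_itv /= => /andP[y0 y1] xy.
  have [|||z [h1 h2 h3]] := @Eplus_nowhere_dense ((x + y) / 2) y; try lra.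
  by exists z; split=> //; lra.
move=> x xcl; apply/seteqP; split=> [y|_ ->]; last exact: connected_component_refl.
move=> [C [Cx CE]] /connected_intervalP iC Cy /=.
have [yx|xy|//] := ltgtP y x; exfalso.
  have [z [z1 z2]] := key _ _ (CE _ Cy) (CE _ Cx) yx; apply; apply: CE.
  by apply: (iC _ _ Cy Cx); rewrite !ltW.
have [z [z1 z2]] := key _ _ (CE _ Cx) (CE _ Cy) xy; apply; apply: CE.
by apply: (iC _ _ Cx Cy); rewrite !ltW.
Qed.

(** Perfectness passes from E+ to its closure. *)
Lemma Eplus_reaches_cantor : Eplus_reaches -> cantor_set (closure (Eplus beta)).
Proof.
move=> Q; split; [|exact: closure_Eplus_compact| |exact: closure_Eplus_totally_disconnected].
  by exists 0; exact/subset_closure/Eplus0.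
split; first exact: closed_closure.
apply/seteqP; split=> x.
  move=> xlim U xU; have [y [_ ycl Uy]] := xlim _ (nbhs_interior xU).
  by have [|a [Ea Ua]] := ycl U; [exact: Uy | exists a].
move=> xcl U xU; have [r r0 rU] := (nbhs_ballP _ _).1 xU.
have [|a [Ea ax]] := xcl (ball x (r / 2)); first by apply: nbhsx_ballx; rewrite divr_gt0.
have [r2] : 0 < r / 2 by rewrite divr_gt0.
have [b Eb [ba bar]] := Eplus_dense_in_itself Q Ea r2.
have [ax'|ax'] := eqVneq a x.
  exists b; split; [by rewrite -ax'|exact: subset_closure|].
  by apply: rU; rewrite -ball_normE /= distrC -ax'; lra.
exists a; split=> //; first exact: subset_closure.
by apply: rU; apply: le_ball ax; lra.
Qed.

(** * Dimension zero at the critical point *)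

Definition in_ico x (I : R * R) := I.1 <= x < I.2.

(** The preimage of the interval [I.1, I.2) under T restricted to [t0, 1), as a
    list of intervals: it breaks in two only across beta - 1. *)
Definition inverse_pieces (I : R * R) : seq (R * R) :=
  if beta - 1 <= I.1 then [:: (I.1 / beta, I.2 / beta)]
  else if I.2 <= beta - 1 then [:: ((I.1 + 1) / beta, (I.2 + 1) / beta)]
  else [:: (t0, I.2 / beta); ((I.1 + 1) / beta, 1)].

(** Multiplicities are preserved because T is injective on [t0, 1). *)
Lemma count_inverse_pieces y I : t0 <= I.1 -> I.2 <= 1 -> t0 <= y < 1 ->
  count (in_ico y) (inverse_pieces I) = in_ico (T y) I.
Proof.
case: I => c d /= tc d1 /andP[ty y1]; rewrite /inverse_pieces /in_ico /=.
have by1 : beta - 1 <= beta * y by rewrite -bt0 mulb_le.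
have by2 : beta * y < beta by rewrite gtr_pMr.
have y0 : 0 <= y by rewrite (le_trans _ ty)// ltW.
have c0 : 0 < c by exact: lt_le_trans tc.
have bt := hb2.
have [h|h] := ltP (beta * y) 1.
  rewrite beta_map_lo//; case: ifPn => hc; [|rewrite -ltNge in hc; case: ifPn => hd].
  - by rewrite /= divb_le divb_gt addn0.
  - have -> : (beta * y < d) = false by apply/negbTE; rewrite -leNgt; lra.
    rewrite /= divb_le divb_gt addn0 andbF.
    by have -> : (c + 1 <= beta * y) = false by apply/negbTE; rewrite -ltNge; lra.
  - rewrite -ltNge in hd; rewrite /= divb_le divb_gt ty y1 addn0 /=.
    have -> : (c + 1 <= beta * y) = false by apply/negbTE; rewrite -ltNge; lra.
    have -> : c <= beta * y by lra.
    by rewrite /= addn0.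
rewrite beta_map_hi//; case: ifPn => hc; [|rewrite -ltNge in hc; case: ifPn => hd].
- have -> : (c <= beta * y - 1) = false by apply/negbTE; rewrite -ltNge; lra.
  rewrite /= divb_le divb_gt addn0.
  have -> : (beta * y < d) = false by apply/negbTE; rewrite -leNgt; lra.
  by rewrite andbF.
- by rewrite /= divb_le divb_gt addn0 lerBrDr ltrBlDr.
- rewrite -ltNge in hd; rewrite /= divb_le divb_gt ty y1 addn0 andbT.
  have -> : (beta * y < d) = false by apply/negbTE; rewrite -leNgt; lra.
  by have -> : beta * y - 1 < d by [lra]; rewrite lerBrDr andbT.
Qed.

Lemma inverse_pieces_sub I J (e : R) : t0 <= I.1 -> I.2 <= 1 -> I.2 - I.1 <= e ->
  J \in inverse_pieces I -> [/\ t0 <= J.1, J.2 <= 1 & J.2 - J.1 <= e / beta].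
Proof.
case: I => c d /= tc d1 de.
have c0 : 0 < c by exact: lt_le_trans tc.
have bt := hb2; have b1 := hb1; have tE := bt0; have t0b : t0 = (beta - 1) / beta.
  by rewrite -bt0; field; rewrite gt_eqF.
have E1 : (1 : R) = beta / beta by rewrite divff// gt_eqF.
rewrite /inverse_pieces /=; case: ifPn => hc; [|rewrite -ltNge in hc; case: ifPn => hd].
- rewrite inE => /eqP -> /=; split.
  + by rewrite t0b ler_pM2r// invr_gt0.
  + by rewrite divb_le; lra.
  + by rewrite -mulrBl ler_pM2r// invr_gt0.
- rewrite inE => /eqP -> /=; split.
  + by rewrite t0b ler_pM2r ?invr_gt0//; lra.
  + by rewrite divb_le; lra.
  + by rewrite -mulrBl ler_pM2r ?invr_gt0//; lra.
- rewrite -ltNge in hd; rewrite !inE => /orP[] /eqP -> /=; split => //.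
  + by rewrite divb_le; lra.
  + by rewrite t0b -mulrBl ler_pM2r ?invr_gt0//; lra.
  + by rewrite t0b ler_pM2r ?invr_gt0//; lra.
  + by rewrite {1}E1 -mulrBl ler_pM2r ?invr_gt0//; lra.
Qed.

Lemma size_inverse_pieces I :
  (size (inverse_pieces I) <= 1 + in_ico (beta - 1)%R I)%N.
Proof.
rewrite /inverse_pieces /in_ico; case: ifPn => [//|]; rewrite -ltNge => h1.
by case: ifPn => [//|]; rewrite -ltNge => ->; rewrite ltW.
Qed.

(** Disjointness of the intervals is recorded as multiplicity at most 1 at every
    point: applied at beta - 1 it bounds the growth of the list by 1, and it is
    inherited through [count_inverse_pieces]. *)
Lemma rotation_cover n : exists ivs : seq (R * R), [/\ (size ivs <= n.+1)%N,
  forall I, I \in ivs -> [/\ t0 <= I.1, I.2 <= 1 & I.2 - I.1 <= beta^-1 ^+ n],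
  forall y, (count (in_ico y) ivs <= 1)%N &
  forall x, 0 <= x < 1 -> (forall i, t0 <= iter i T x) -> has (in_ico x) ivs].
Proof.
elim: n => [|n [ivs [sz sub mult cov]]].
  exists [:: (t0, 1)]; split=> //.
  - move=> I; rewrite inE => /eqP -> /=; split=> //.
    by have := t0_gt0; rewrite expr0; lra.
  - by move=> y; rewrite /= addn0 leq_b1.
  - by move=> x /andP[_ x1] xt; rewrite /= orbF /in_ico x1 andbT; exact: (xt 0%N).
exists (flatten (map inverse_pieces ivs)).
have sub' J : J \in flatten (map inverse_pieces ivs) ->
    [/\ t0 <= J.1, J.2 <= 1 & J.2 - J.1 <= beta^-1 ^+ n.+1].
  move=> /flatten_mapP[I /sub[h1 h2 h3] /(inverse_pieces_sub h1 h2 h3)].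
  by rewrite exprSr.
have countE y : t0 <= y < 1 -> count (in_ico y) (flatten (map inverse_pieces ivs)) =
    count (in_ico (T y)) ivs.
  move=> y01; elim: (ivs) sub => [//|I s IH] sub; rewrite /= count_cat.
  have [h1 h2 _] := sub I (mem_head _ _).
  rewrite count_inverse_pieces// IH// => J Js; apply: sub.
  by rewrite inE Js orbT.
split=> //.
- have : (size (flatten (map inverse_pieces ivs)) <=
          size ivs + count (in_ico (beta - 1)%R) ivs)%N.
    elim: (ivs) => [//|I s IH]; rewrite /= size_cat.
    by have := size_inverse_pieces I; lia.
  by have := mult (beta - 1); lia.
- move=> y; have [y01|ny] := boolP (t0 <= y < 1); first by rewrite countE.
  rewrite (@eq_in_count _ _ pred0) ?count_pred0// => J /sub'[h1 h2 _].
  apply/negbTE; apply: contra ny => /andP[h3 h4].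
  by rewrite (le_trans h1 h3) (lt_le_trans h4 h2).
- move=> x x01 xt; rewrite has_count countE; last first.
    by have /andP[_ ->] := x01; rewrite andbT; exact: (xt 0%N).
  rewrite -has_count; apply: cov; first exact: beta_map_range.
  by move=> i; rewrite -iterSr.
Qed.

Definition digits_value (w : seq bool) : R :=
  foldr (fun (d : bool) v => (d%:R + v) / beta) 0 w.

Lemma preimage_of_zero n x : 0 <= x < 1 -> iter n T x = 0 ->
  exists w : seq bool, x = digits_value w.
Proof.
elim: n x => [|n IH] x x01; first by move=> /= ->; exists [::].
rewrite iterSr => /(IH _ (beta_map_range x))[w Ew].
have /andP[x0 x1] := x01; have [h|h] := ltP (beta * x) 1.
  exists (false :: w); rewrite /= -Ew beta_map_lo// add0r.
  by field; rewrite gt_eqF.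
exists (true :: w); rewrite /= -Ew beta_map_hi// subrKC.
by field; rewrite gt_eqF.
Qed.

(** An orbit that never hits 0 has its infimum in E+, and the gap lifts this
    infimum above t0; the orbits that hit 0 are countably many. *)
Lemma survivor_dim0 t : 0 < t -> (forall a, Eplus beta a -> t <= a -> t0 <= a) ->
  ~ (0 < hausdorff_dim (survivor_set beta t))%E.
Proof.
move=> tgt0 gap.
apply: (@thin_cover_dim0 _ _ [set x | 0 <= x < 1 /\ forall i, t0 <= iter i T x]
  beta^-1 digits_value).
- by rewrite invr_gt0 b0 invf_lt1.
- move=> n; have [ivs [sz sub _ cov]] := rotation_cover n.
  exists ivs; split=> // [x [x01 xt]|I /sub[]//].
  have /hasP[I Ii /andP[h1 h2]] := cov x x01 xt.
  by exists I; rewrite ?h1 ?ltW.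
- move=> x [+ xK]; rewrite in_itv /= => x01.
  have [[n xn]|nz] := pselect (exists n, iter n T x = 0).
    by right; exact: preimage_of_zero xn.
  left; split=> // i.
  have xt n : t <= iter n T x.
    have := xK n; rewrite in_itv /= negb_and -!leNgt => /orP[h|//].
    exfalso; apply: nz; exists n; apply/eqP; rewrite eq_le h /=.
    by have /andP[] := iter_range n x01.
  have [m [Em tm mx]] := Eplus_orbit_inf x01 xt.
  exact: le_trans (gap m Em tm) (mx i).
Qed.

(** * Coding a self-similar subset of a survivor set *)

Definition branch N (c y : R) := y / beta ^+ N + c.

(** [branch N c] is an inverse branch of the N-th iterate on [a, b), along orbits
    that stay above [a]. *)
Definition return_branch a b N (c : R) := forall y, a <= y < b ->
  [/\ a <= branch N c y < b, iter N T (branch N c y) = y &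
      forall i, (i <= N)%N -> a <= iter i T (branch N c y)].

Lemma branch_le N c y y' : (branch N c y <= branch N c y') = (y <= y').
Proof. by rewrite lerD2r ler_pM2r// invr_gt0. Qed.

Lemma branch_comp N N' c c' y :
  branch N c (branch N' c' y) = branch (N' + N) (branch N c c') y.
Proof. by rewrite /branch exprD; field; rewrite !gt_eqF. Qed.

Lemma return_branch_comp a b N N' c c' :
  return_branch a b N c -> return_branch a b N' c' ->
  return_branch a b (N' + N) (branch N c c').
Proof.
move=> B B' y yab; rewrite -branch_comp.
have [r' e' o'] := B' y yab; have [r e o] := B _ r'.
split=> //; first by rewrite iterD e.
move=> i iN; have [iN'|/ltnW] := leqP i N; first exact: o.
by move=> /subnK iE; rewrite -iE iterD e; apply: o'; rewrite leq_subLR addnC.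
Qed.

(** Two separated return branches with the same return time N, hence the same
    ratio r = beta^-N, code the points of [0, 1) through their binary digits.
    Two numbers that first differ at digit k are at distance at most 2^-k, and
    their codes at distance at least gamma * r^k; so the inverse of the coding is
    Hölder of the exponent s for which r^s = 1/2. *)
Section Coding.
Variables (a b b' gamma : R) (N : nat) (c : bool -> R).
Hypotheses (a0 : 0 <= a) (b1 : b <= 1) (ab' : a <= b') (bb' : b' < b).
Hypotheses (N0 : (0 < N)%N) (gamma0 : 0 < gamma).
Hypothesis branchP : forall d, return_branch a b N (c d).
Hypothesis branchb' : forall d y, a <= y < b -> branch N (c d) y <= b'.
Hypothesis branch_gap : forall y y', a <= y < b -> a <= y' < b ->
  branch N (c false) y + gamma <= branch N (c true) y'.

Definition digit (y : R) : bool := 2^-1 <= y.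
Definition doubling (y : R) : R := 2 * y - (digit y)%:R.

Lemma doubling_range y : 0 <= y < 1 -> 0 <= doubling y < 1.
Proof.
move=> /andP[y0 y1]; rewrite /doubling /digit; have [h|h] := leP 2^-1 y.
  by apply/andP; split => /=; lra.
by apply/andP; split => /=; lra.
Qed.

Fixpoint code_prefix n (y : R) : R :=
  if n is n'.+1 then branch N (c (digit y)) (code_prefix n' (doubling y)) else a.

Lemma code_prefix_range n y : a <= code_prefix n y <= b'.
Proof.
have bb := bb'; elim: n y => [|n IH] y; first by rewrite /= lexx ab'.
have /andP[h1 h2] := IH (doubling y).
have h : a <= code_prefix n (doubling y) < b by rewrite h1 (le_lt_trans h2).
by have [/andP[-> _] _ _] := branchP (digit y) h; rewrite /= branchb'.
Qed.

(** The limit point of the nested branches, as the supremum of the images of the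
    left end point [a], which are nondecreasing in n. *)
Definition code y := sup [set code_prefix n y | n in [set: nat]].

Let code_has_sup y : has_sup [set code_prefix n y | n in [set: nat]].
Proof.
split; first by exists a; exists 0%N.
by exists b' => _ [n _ <-]; have /andP[] := code_prefix_range n y.
Qed.

Lemma code_range y : a <= code y <= b'.
Proof.
apply/andP; split; first by apply: (ub_le_sup (code_has_sup y).2); exists 0%N.
apply: ge_sup; first exact: (code_has_sup y).1.
by move=> _ [n _ <-]; have /andP[] := code_prefix_range n y.
Qed.

Let code_in y : a <= code y < b.
Proof. by have /andP[-> h] := code_range y; rewrite (le_lt_trans h). Qed.

(** Branches are increasing affine bijections, so they commute with suprema. *)
Lemma codeE y : code y = branch N (c (digit y)) (code (doubling y)).
Proof.
have BP := branchP (digit y).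
apply/eqP; rewrite eq_le; apply/andP; split.
  apply: ge_sup; first exact: (code_has_sup y).1.
  move=> _ [[|n] _ <-] /=; first by have [/andP[]] := BP _ (code_in (doubling y)).
  rewrite branch_le; apply: (ub_le_sup (code_has_sup _).2); by exists n.
rewrite /branch -lerBrDr ler_pdivrMr//.
apply: ge_sup; first exact: (code_has_sup _).1.
move=> _ [n _ <-]; rewrite -ler_pdivrMr// lerBrDr.
by apply: (ub_le_sup (code_has_sup y).2); exists n.+1.
Qed.

Lemma code_survives y : survivor_set beta a (code y).
Proof.
have /andP[h1 h2] := code_in y; split.
  by rewrite in_itv /= (le_trans a0 h1) (lt_le_trans h2 b1).
move=> n; rewrite in_itv /= negb_and -!leNgt; apply/orP; right.
elim/ltn_ind: n y {h1 h2} => n IH y.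
rewrite codeE; have [_ e o] := branchP (digit y) (code_in (doubling y)).
have [nN|Nn] := leqP n N; first exact: o.
rewrite -(subnK (ltnW Nn)) iterD [X in iter _ _ X]e; apply: IH.
by rewrite ltn_subrL N0 (leq_trans _ Nn).
Qed.

Let s := ln 2 / - ln (beta ^- N).

Let lnr : ln (beta ^- N) < 0.
Proof.
apply: ln_lt0; rewrite invr_gt0 bX_gt0 invf_lt1//.
by case: N N0 => // k _; exact: bX_gt1.
Qed.

Let s0 : 0 < s.
Proof. by rewrite /s divr_gt0 ?oppr_gt0// ln_gt0// ltr1n. Qed.

Let rs : (beta ^- N) `^ s = 2^-1.
Proof.
have r0 : 0 < beta ^- N by rewrite invr_gt0.
rewrite -[RHS]lnK ?posrE// -[LHS]lnK ?posrE ?powR_gt0//; congr expR.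
rewrite ln_powR [ln 2^-1]lnV ?posrE// /s; field.
by rewrite lt_eqF; last exact: lnr.
Qed.

(** By self-similarity both sides double when a common leading digit is
    removed; it is removed until the digits differ, where the gap applies. *)
Lemma code_holder y y' : 0 <= y < 1 -> 0 <= y' < 1 ->
  gamma `^ s * `|y - y'| <= `|code y - code y'| `^ s.
Proof.
have sep z z' : 0 <= z < 1 -> 0 <= z' < 1 -> ~~ digit z -> digit z' ->
    gamma `^ s * `|z - z'| <= `|code z - code z'| `^ s.
  move=> /andP[z0 z1] /andP[z'0 z'1] dz dz'.
  have g : gamma <= `|code z - code z'|.
    have := branch_gap (code_in (doubling z)) (code_in (doubling z')).
    rewrite [code z]codeE [code z']codeE dz' (negbTE dz).
    move=> h; rewrite distrC; apply: le_trans (ler_norm _); lra.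
  apply: (@le_trans _ _ (gamma `^ s)).
    rewrite ler_piMr ?powR_ge0// ler_norml; apply/andP; split; lra.
  by apply: ge0_ler_powR => //; rewrite ?nnegrE ?(ltW s0) ?(ltW gamma0).
move=> y01 y'01; have [->|yy'] := eqVneq y y'.
  by rewrite subrr normr0 mulr0 powR_ge0.
have [||n] := @exprn_small R 2^-1 `|y - y'|; [|by rewrite normr_gt0 subr_eq0|].
  by rewrite invr_ge0 ler0n /=; lra.
elim: n y y' y01 y'01 {yy'} => [|n IH] y y' y01 y'01.
  rewrite expr0 => h; exfalso; have /andP[? ?] := y01; have /andP[? ?] := y'01.
  have : `|y - y'| < 1 by rewrite ltr_norml; apply/andP; split; lra.
  lra.
move=> hn; have [dd|] := eqVneq (digit y) (digit y'); last first.
  case dy : (digit y); case dy' : (digit y') => // _.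
    by rewrite distrC [`|code y - _|]distrC; apply: sep; rewrite ?dy ?dy'.
  by apply: sep; rewrite ?dy ?dy'.
have dE : `|doubling y - doubling y'| = 2 * `|y - y'|.
  by rewrite /doubling dd opprB addrA subrK -mulrBr normrM ger0_norm.
have cE : `|code y - code y'| = beta ^- N * `|code (doubling y) - code (doubling y')|.
  rewrite [code y]codeE [code y']codeE dd /branch opprD addrACA subrr addr0.
  by rewrite -mulrBl normrM mulrC ger0_norm// invr_ge0 ltW.
rewrite cE powRM// ?invr_ge0 ?(ltW (bX_gt0 _))// rs.
have := IH _ _ (doubling_range y01) (doubling_range y'01); rewrite dE.
have : 2^-1 ^+ n <= 2 * `|y - y'| by move: hn; rewrite exprS; lra.
move=> h1 /(_ h1); lra.
Qed.

Lemma coding_dim_gt0 : (0 < hausdorff_dim (survivor_set beta a))%E.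
Proof.
apply: (@hausdorff_dim_gt0 _ _ code (gamma `^ s) s).
- exact: powR_gt0.
- exact: s0.
- by move=> y _; exact: code_survives.
- exact: code_holder.
Qed.

End Coding.

(** * A horseshoe between a point of E+ and the critical point *)

Definition cut_offset a n := a + (1 / beta - iter n T a) / beta ^+ n.

(** The part of [a', t0) that is right of the cut is mapped onto an interval
    [0, L^(n+1) t0), which covers [a, t0) by [left_orbit_t0_ge]; before that, the
    orbits lie above that of a' and so above a'. *)
Lemma return_branch_above a a' n (c := cut_offset a' n) : Eplus_reaches ->
  0 <= a -> Eplus beta a' -> a <= a' < t0 -> first_cut a' t0 n ->
  return_branch a t0 n.+1 c /\
  forall y, a <= y < t0 -> a' <= branch n.+1 c y < t0.
Proof.
move=> Q a0 [_ a'T] /andP[aa' a't0] [nL nT cutl cutr].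
have a'0 : 0 <= a' by exact: le_trans aa'.
have t01 : t0 <= 1 by have /andP[] := t0_01.
have Lm : t0 <= beta * iter n L t0 - 1.
  by rewrite -left_map_hi// -iterS; exact: left_orbit_t0_ge.
have dist y : beta ^+ n * (branch n.+1 c y - a') = (y + 1) / beta - iter n T a'.
  by rewrite /branch /c /cut_offset exprS; field; rewrite !gt_eqF.
have rng y : a <= y < t0 -> a' <= branch n.+1 c y < t0.
  move=> /andP[ay yt]; apply/andP; split.
    rewrite -subr_ge0 -(pmulr_rge0 _ (bX_gt0 n)) dist subr_ge0.
    rewrite ler_pdivlMr// mulrC (le_trans (ltW cutl))// lerDr.
    exact: le_trans ay.
  rewrite -(ltrD2r (- a')) -(ltr_pM2l (bX_gt0 n)) dist ltrBlDl -nL//.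
  by rewrite ltr_pdivrMr// mulrC; lra.
have Tn y i : a <= y < t0 -> (i <= n)%N ->
    iter i T (branch n.+1 c y) = iter i T a' + beta ^+ i * (branch n.+1 c y - a').
  by move=> yat ile; apply: nT => //; exact: rng.
have bTn y : a <= y < t0 -> beta * iter n T (branch n.+1 c y) = y + 1.
  by move=> yat; rewrite Tn// dist subrKC mulrC divfK// gt_eqF.
have Tn1 y : a <= y < t0 -> iter n.+1 T (branch n.+1 c y) = y.
  move=> yat; have /andP[r1 r2] := rng y yat; have /andP[ay yt] := yat.
  have b01 : 0 <= branch n.+1 c y < 1 by rewrite (le_trans a'0 r1) (lt_le_trans r2).
  rewrite iterS beta_map_hi ?bTn// ?addrK//.
    by rewrite lerDr (le_trans a0).
  by have /andP[] := iter_range n b01.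
split; last exact: rng.
move=> y yat; have /andP[r1 r2] := rng y yat; split.
- by rewrite (le_trans aa' r1) r2.
- exact: Tn1.
- move=> i; rewrite leq_eqVlt => /orP[/eqP ->|ile].
    by rewrite Tn1//; have /andP[] := yat.
  rewrite Tn//; have := a'T i => h.
  apply: le_trans aa' (le_trans h _).
  by rewrite lerDl mulr_ge0 ?subr_ge0// ltW.
Qed.

(** The right part of [a, t0) after its first cut is one branch.  The left part
    covers [T^(n+1) a, 1); choosing a' in E+ with a' + 1 / beta in that interval,
    T identifies a neighbourhood of 1 with [a', t0), from where
    [return_branch_above] leads back over [a, t0). *)
Lemma horseshoe a : Eplus_reaches -> Eplus beta a -> 0 <= a < t0 ->
  exists N0 N1 c0 c1, [/\ return_branch a t0 N0.+1 c0, return_branch a t0 N1.+1 c1 &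
    forall y y', a <= y < t0 -> a <= y' < t0 ->
      branch N0.+1 c0 y <= branch N1.+1 c1 y'].
Proof.
move=> Q Ea /andP[a0 at0]; have t01 : t0 <= 1 by have /andP[] := t0_01.
have aat : a <= a < t0 by rewrite lexx.
have [n cut] := first_cut_exists a0 at0 t01.
have [B1 _] := return_branch_above Q a0 Ea aat cut.
move: cut => [nL nT cutl cutr].
have st0 : Num.max a (beta * iter n T a - 1 / beta) < t0.
  by rewrite gt_max at0 /=; move: cutl; rewrite /critical_point; lra.
have [a' Ea' /andP[]] := Q _ st0; rewrite ge_max => /andP[aa' ca'] a't0.
have [n' cut'] := first_cut_exists (le_trans a0 aa') a't0 t01.
have aat' : a <= a' < t0 by rewrite aa'.
have [] := return_branch_above Q a0 Ea' aat' cut'.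
set c' := cut_offset a' n' => B' r'.
have bib : beta * (1 / beta) = 1 by rewrite mulrC divfK// gt_eqF.
(* z y and z y - 1 / beta have the same image under T. *)
pose z y := branch n'.+1 c' y + 1 / beta.
pose c0 := a + ((c' + 1 / beta) / beta - iter n T a) / beta ^+ n.
have dist y : beta ^+ n * (branch (n' + n.+1).+1 c0 y - a) = z y / beta - iter n T a.
  rewrite /branch /c0 /z /branch !exprS exprD exprS.
  by field; rewrite !gt_eqF.
have zlt y : a <= y < t0 -> z y < 1.
  by move=> /r' /andP[_]; rewrite /z /critical_point; lra.
have zge y : a <= y < t0 -> beta * iter n T a <= z y.
  by move=> /r' /andP[h _]; rewrite /z; lra.
have rng y : a <= y < t0 -> a <= branch (n' + n.+1).+1 c0 y < t0.
  move=> yat; apply/andP; split.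
    rewrite -subr_ge0 -(pmulr_rge0 _ (bX_gt0 n)) dist subr_ge0.
    by rewrite ler_pdivlMr// mulrC zge.
  rewrite -(ltrD2r (- a)) -(ltr_pM2l (bX_gt0 n)) dist ltrBlDl -nL//.
  by rewrite ltr_pdivrMr// mulrC (lt_trans (zlt _ yat)).
have Tn y i : a <= y < t0 -> (i <= n)%N -> iter i T (branch (n' + n.+1).+1 c0 y) =
    iter i T a + beta ^+ i * (branch (n' + n.+1).+1 c0 y - a).
  by move=> yat ile; apply: nT => //; exact: rng.
have bTn y : a <= y < t0 -> beta * iter n T (branch (n' + n.+1).+1 c0 y) = z y.
  by move=> yat; rewrite Tn// dist subrKC mulrC divfK// gt_eqF.
have Tn1 y : a <= y < t0 -> iter n.+1 T (branch (n' + n.+1).+1 c0 y) = z y.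
  move=> yat; have /andP[r1 r2] := rng y yat.
  have b01 : 0 <= branch (n' + n.+1).+1 c0 y < 1.
    by rewrite (le_trans a0 r1) (lt_le_trans r2).
  have /andP[h _] := iter_range n b01.
  by rewrite iterS beta_map_lo ?bTn ?zlt.
have Tz y : a <= y < t0 -> T (z y) = T (branch n'.+1 c' y).
  move=> yat; have /andP[r1 r2] := r' y yat.
  have p0 : 0 <= branch n'.+1 c' y by rewrite (le_trans a0)// (le_trans aa').
  have bz : beta * z y = beta * branch n'.+1 c' y + 1 by rewrite /z mulrDr bib.
  rewrite beta_map_hi ?zlt ?bz ?lerDr ?mulr_ge0 ?(ltW b0)//.
  by rewrite beta_map_lo ?addrK// (lt_trans _ bt0_lt1)// mulb_lt.
exists (n' + n.+1)%N, n, c0, (cut_offset a n); split=> //.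
  move=> y yat; have [_ e' o'] := B' y yat.
  have after i : iter (i.+1 + n.+1) T (branch (n' + n.+1).+1 c0 y) =
      iter i.+1 T (branch n'.+1 c' y).
    by rewrite iterD Tn1// iterSr Tz// -iterSr.
  split; [exact: rng|by rewrite -addSn after|].
  move=> i ile; have [iln|] := leqP i n.
    rewrite Tn//; have [_ /(_ i)] := Ea => h; apply: (le_trans h).
    by rewrite lerDl mulr_ge0 ?(ltW (bX_gt0 _))// subr_ge0; have /andP[] := rng y yat.
  move=> /subnK iE; rewrite -iE; case E : (i - n.+1)%N iE => [|j] iE.
    rewrite add0n Tn1// /z; have /andP[h _] := r' y yat.
    by rewrite (le_trans aa')// (le_trans h)// lerDl divr_ge0// ltW.
  by rewrite after; apply: o'; move: ile; rewrite -iE -addSn leq_add2r.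
move=> y y' yat y'at.
rewrite -(lerD2r (- a)) -(ler_pM2l (bX_gt0 n)) dist.
have -> : beta ^+ n * (branch n.+1 (cut_offset a n) y' - a) =
    (y' + 1) / beta - iter n T a.
  by rewrite /branch /cut_offset exprS; field; rewrite !gt_eqF.
rewrite lerD2r ler_pM2r ?invr_gt0// (le_trans (ltW (zlt _ yat)))// lerDr.
by have /andP[h _] := y'at; exact: le_trans h.
Qed.

(** The two branches f < g of the horseshoe may touch and may have different return
    times.  The words f f g and g f f have equal return times, and f g lies
    between them, which provides the gap. *)
Lemma survivor_dim_gt0 t : Eplus_reaches -> t < t0 ->
  (0 < hausdorff_dim (survivor_set beta t))%E.
Proof.
move=> Q tt0.
have st0 : Num.max t 0 < t0 by rewrite gt_max tt0 t0_gt0.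
have [a Ea /andP[]] := Q _ st0; rewrite ge_max => /andP[ta a0] at0.
have t01 : t0 <= 1 by have /andP[] := t0_01.
have [|N0 [N1 [c0 [c1 [B0 B1 ord]]]]] := horseshoe Q Ea; first by rewrite a0.
have ain : a <= a < t0 by rewrite lexx.
pose f := branch N0.+1 c0; pose g := branch N1.+1 c1.
have fin y : a <= y < t0 -> a <= f y < t0 by move=> /B0[].
have gin y : a <= y < t0 -> a <= g y < t0 by move=> /B1[].
have fmono : {mono f : y y' / y <= y'} by move=> y y'; exact: branch_le.
have gmono : {mono g : y y' / y <= y'} by move=> y y'; exact: branch_le.
pose N := (N1.+1 + N0.+1 + N0.+1)%N.
pose k0 := branch N0.+1 c0 (branch N0.+1 c0 c1).
pose k1 := branch N1.+1 c1 (branch N0.+1 c0 c0).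
have NE : N = (N0.+1 + N0.+1 + N1.+1)%N by rewrite /N -addnA addnC.
have E0 y : branch N k0 y = f (f (g y)).
  by rewrite /N /k0 -branch_comp -branch_comp.
have E1 y : branch N k1 y = g (f (f y)).
  by rewrite NE /k1 -branch_comp -branch_comp.
have BB d : return_branch a t0 N (if d then k1 else k0).
  case: d.
    by rewrite NE; apply: return_branch_comp => //; exact: return_branch_comp.
  by apply: return_branch_comp => //; exact: return_branch_comp.
pose e := (a + t0) / 2.
have ein : a <= e < t0 by rewrite /e; apply/andP; split; lra.
have ae : a < e by rewrite /e; lra.
have gap0 : 0 < f (g e) - f (g a).
  by rewrite subr_gt0 (leW_mono fmono) (leW_mono gmono).
have dim_a : (0 < hausdorff_dim (survivor_set beta a))%E.
  apply: (@coding_dim_gt0 a t0 (g (g a)) (f (g e) - f (g a)) N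
    (fun d => if d then k1 else k0)) => //.
  - by have /andP[] := gin _ (gin _ ain).
  - by have /andP[] := gin _ (gin _ ain).
  - case=> y yin; rewrite ?E0 ?E1.
      by rewrite gmono; apply: ord; [exact: fin|].
    by apply: ord; [exact/fin/gin|exact: gin].
  - move=> y y' yin y'in; rewrite E0 E1.
    apply: (@le_trans _ _ (f (g e))).
      rewrite addrCA gerDl subr_le0 fmono; apply: ord => //; exact: gin.
    apply: ord; [exact: gin|exact/fin/fin].
have sub : survivor_set beta a `<=` survivor_set beta t.
  move=> x [x01 xa]; split=> // n; apply: contra (xa n).
  by rewrite !in_itv /= => /andP[-> h]; exact: lt_le_trans ta.
apply: lt_le_trans dim_a _; exact: hausdorff_dim_mono.
Qed.

(** * The critical hole *)

Lemma critical_iff_reaches : is_critical_hole beta t0 <-> Eplus_reaches.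
Proof.
have t01 : t0 \in `[0, 1[.
  rewrite in_itv /= ltW//= /critical_point ltrBlDr ltrDl divr_gt0//.
split=> [[_ crit] t tt0|Q].
  apply: contrapT => gap; pose t' := Num.max t (t0 / 2).
  have t'0 : 0 < t' by rewrite lt_max divr_gt0// orbT.
  have t't0 : t' < t0 by rewrite gt_max tt0; have := t0_gt0; lra.
  have t'01 : t' \in `[0, 1[.
    by rewrite in_itv /= ltW//=; move: t01; rewrite in_itv /= => /andP[_]; exact: lt_trans.
  apply: (@survivor_dim0 t' t'0 _ ((crit t' t'01).2 t't0)) => a Ea t'a.
  rewrite leNgt; apply/negP => at0; apply: gap; exists a => //.
  by rewrite at0 andbT (le_trans _ t'a)// le_max lexx.
split=> // t tin; split; last exact: survivor_dim_gt0.
move=> dim; rewrite ltNge; apply/negP => t0t; move: dim.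
apply: survivor_dim0; first exact: lt_le_trans t0t.
by move=> a _; exact: le_trans.
Qed.

Lemma critical_point_gt0 : 0 < t0. Proof. exact: t0_gt0. Qed.

End BetaDynamics.

Theorem theorem4 (R : realType) (beta : R) (hbeta1 : 1 < beta)
    (hbeta2 : beta < 2) :
  tau beta <= 1 - 1 / beta /\
  (tau beta = 1 - 1 / beta <-> cantor_set (closure (Eplus beta))).
Proof.
rewrite -/(critical_point beta); set t0 := critical_point beta.
have t0_gt0 : 0 < t0 by exact: critical_point_gt0.
have crit := critical_iff_reaches hbeta1 hbeta2.
(* Without a critical hole, tau takes its default value 0, which is below t0. *)
have tau0 : (forall c, ~ is_critical_hole beta c) -> tau beta = 0.
  by move=> none; exact: xgetPN.
split.
  have [[c hc]|none] := pselect (exists c, is_critical_hole beta c); last first.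
    by rewrite tau0 ?ltW// => c hc; apply: none; exists c.
  rewrite (tauE hc) leNgt; apply/negP => t0c; case: hc => c01 hc.
  have t01 : t0 \in `[0, 1[.
    move: c01; rewrite !in_itv /= (ltW t0_gt0) /= => /andP[_].
    exact: lt_trans.
  apply: (@survivor_dim0 _ _ hbeta1 hbeta2 t0 t0_gt0 _ ((hc t0 t01).2 t0c)).
  by [].
split=> [tauE0|[_ _ perf _]].
  apply: Eplus_reaches_cantor => //; apply/crit.
  have [[c hc]|none] := pselect (exists c, is_critical_hole beta c).
    by have := tauE hc; rewrite tauE0 /t0 => ->.
  have := tau0 (fun c hc => none (ex_intro _ c hc)).
  by rewrite tauE0 => t00; move: t0_gt0; rewrite t00 ltxx.
by apply: tauE; apply/crit; exact: perfect_Eplus_reaches perf.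
Qed.
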